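(* Consider a distributed stochastic bandit problem with $N$ options, $K$ agents and $T$ time steps, in which the communication graph $G$ is a symmetric multi-star graph with $m$ center agents and $K-m$ peripheral agents, and every agent broadcasts its reward and action to its neighbors with probability $p$ at each time step. Let $\xi>1$ and suppose that all agents sample according to the heterogeneous sampling rules with parameter $\xi$. Then there is a constant $\zeta>1$ such that the expected cumulative group regret satisfies $$\mathbb{E}(R(T)) \leq c_1(K,m,\alpha,p)\sum_{i:\,\Delta_i>0}\frac{8\sigma_i^2(\xi+1)\log T}{\Delta_i} + \frac{2}{\log \zeta}\sum_{i=1}^N\Delta_i \left( K\log (1+d_{avg}) +(K-m)\frac{\xi\log 2 + 1}{\xi^2} + m\,\frac{\log (1+d_{cen})(\xi\alpha+\xi+\alpha) + 1}{(\xi\alpha+\xi+\alpha)^2} \right),$$ where $$c_1(K,m,\alpha,p) = K-m + \frac{m(1+\alpha)}{1+p(m-1)}\left[1-p\,\frac{K-m}{m}\right]^+ .$$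
   Context: **Bandit problem.** There are $K$ agents, each facing the same $N$-armed bandit problem for $T$ time steps. At each time $t\in\{1,\dots,T\}$ each agent $k$ chooses an option $\varphi_t^k\in\{1,\dots,N\}$ and receives a stochastic reward drawn from the fixed distribution of the chosen option. The reward of option $i$ is a sub-Gaussian random variable $X_i$ with mean $\mu_i=\mathbb{E}(X_i)$ and variance proxy $\sigma_i^2$, $\sigma_i>0$ (known to all agents); as usual in the stochastic bandit problem, different draws are independent. Let $i^*=\arg\max_i\mu_i$ be the optimal option and $\Delta_i=\mu_{i^*}-\mu_i$. **Graph.** $G(\mathcal V,\mathcal E)$ is a fixed undirected graph whose vertices are the $K$ agents; $e(k,j)\in\mathcal E$ means $k,j$ are neighbors. $d_k$ is the degree of agent $k$, $d_{avg}=\frac1K\sum_{k=1}^K d_k$, and $d_k^{avg}=\frac{1}{d_k}\sum_{j:\,e(k,j)\in\mathcal E}d_j$ is the average degree of the neighbors of $k$. A symmetric multi-star graph with $m$ center agents: agents $k\le m$ are center agents and are all neighbors of one another; each peripheral agent $k>m$ has exactly one neighbor, which is a center agent; all center agents have the same number of neighbors (so $K-m$ is an integer multiple of $m$). Each center agent has degree $d_{cen}=\frac{K-m}{m}+m-1$. **Communication.** At each time step each agent broadcasts its current reward and action to its neighbors with probability $p\in[0,1]$. $\mathbb{I}^t_{\{k,j\}}$ is the indicator that agent $k$ receives information from agent $j$ at time $t$: $\mathbb{E}(\mathbb{I}^t_{\{k,j\}})=p$ if $e(k,j)\in\mathcal E$, $\mathbb{I}^t_{\{k,k\}}=1$, and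 $\mathbb{E}(\mathbb{I}^t_{\{k,j\}})=0$ otherwise. The communication structure is independent of the decision-making process. **Counts, estimates, regret.** $n_i^k(t)=\sum_{\tau=1}^t\mathbb{I}_{\{\varphi_\tau^k=i\}}$; $N_i^k(t)=\sum_{\tau=1}^t\sum_{j=1}^K\mathbb{I}_{\{\varphi_\tau^j=i\}}\mathbb{I}^\tau_{\{k,j\}}$; $\widehat\mu_i^k(t)=S_i^k(t)/N_i^k(t)$, where $S_i^k(t)=\sum_{\tau=1}^t\sum_{j=1}^K X_i\,\mathbb{I}_{\{\varphi_\tau^j=i\}}\mathbb{I}^\tau_{\{k,j\}}$ is the sum of all rewards from option $i$ observed by agent $k$ up to time $t$ (each $X_i$ in the sum denotes the reward actually drawn by agent $j$ at time $\tau$). The expected cumulative group regret is $\mathbb{E}(R(t))=\sum_{i=1}^N\sum_{k=1}^K\Delta_i\,\mathbb{E}(n_i^k(t))$. **Heterogeneous sampling rules (parameter $\xi>1$).** Agent $k$ chooses at time $t+1$ the option $i$ attaining $\max\{Q_1^k(t),\dots,Q_N^k(t)\}$, where $$Q_i^k(t)=\widehat\mu_i^k(t)+C_i^k(t),\qquad C_i^k(t)=\sigma_i\sqrt{\frac{2(1+\alpha_k)(\xi+1)\log t}{N_i^k(t)}},$$ with $\alpha_k=\dfrac{p^{1-p}(d_k-d_k^{avg})}{d_k}$ for $k\le m$ and $\alpha_k=0$ for $k>m$. By symmetry $\alpha_k$ has the same value for all $k\le m$; this common value is denoted $\alpha$. **Notation.** $[x]^+=\max\{x,0\}$. *)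

(* Defs.v *)
(* MathComp / MathComp-Analysis. *)
From HB Require Import structures.
From mathcomp Require Import all_boot all_order all_algebra.
From mathcomp Require Import all_classical all_reals all_analysis.
Import Order.TTheory GRing.Theory Num.Theory.
Import numFieldNormedType.Exports.

Set Implicit Arguments.
Unset Strict Implicit.
Unset Printing Implicit Defensive.

Local Open Scope classical_set_scope.
Local Open Scope ring_scope.

Definition degree (K : nat) (e : rel 'I_K) (k : 'I_K) : nat :=
  #|[set j : 'I_K | e k j]%SET|.

Definition avg_degree (R : realType) (K : nat) (e : rel 'I_K) : R :=
  (\sum_(k < K) (degree e k)%:R) / K%:R.

Definition nbr_avg_degree (R : realType) (K : nat) (e : rel 'I_K) (k : 'I_K) : R :=
  (\sum_(j < K | e k j) (degree e j)%:R) / (degree e k)%:R.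

(* Agents are numbered from 0: the m centers are the k : 'I_K with k < m. *)
Record symmetric_multi_star (K m : nat) (e : rel 'I_K) : Prop := {
  ms_sym : symmetric e;
  ms_irr : irreflexive e;
  ms_center_gt0 : (0 < m)%N;
  ms_center_le : (m <= K)%N;
  ms_centers : forall k j : 'I_K, (k < m)%N -> (j < m)%N -> k != j -> e k j;
  ms_peripheral : forall k : 'I_K, (m <= k)%N ->
    exists2 c : 'I_K, (c < m)%N & forall j : 'I_K, e k j = (j == c);
  ms_balanced : forall k j : 'I_K, (k < m)%N -> (j < m)%N ->
    degree e k = degree e j
}.

Definition center_degree (R : realType) (K m : nat) : R :=
  (K%:R - m%:R) / m%:R + m%:R - 1.

(* For K = m = 1 the center is isolated and x / 0 = 0 gives the value 0. *)
Definition explore_coef (R : realType) (K m : nat) (e : rel 'I_K) (p : R)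
    (k : 'I_K) : R :=
  if (k < m)%N then
    p `^ (1 - p) * ((degree e k)%:R - nbr_avg_degree R e k) / (degree e k)%:R
  else 0.

(* sigma ^+ 2 is a variance proxy of the law nu, whose mean is mu. *)
Definition sub_gaussian (R : realType) (nu : probability (measurableTypeR R) R)
    (mu sigma : R) : Prop :=
  'E_nu[fun x : R => x]%E = mu%:E /\
  forall lam : R, ('E_nu[fun x : R => expR (lam * (x - mu))] <=
                   (expR (lam ^+ 2 * sigma ^+ 2 / 2))%:E)%E.

(* Times start at 1. In a run,
   - phi t k w is the option chosen by agent k at time t;
   - X t k i is the reward that agent k would draw from option i at time t;
     it is used only on the event phi t k w = i;
   - I t k j w says that agent k receives the information of agent j at t. *)
Section Run.
Context (R : realType) (K N : nat) (Omega : Type).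
Variables (X : nat -> 'I_K -> 'I_N -> Omega -> R)
          (I : nat -> 'I_K -> 'I_K -> Omega -> bool)
          (phi : nat -> 'I_K -> Omega -> 'I_N).

Definition own_count (i : 'I_N) (k : 'I_K) (t : nat) (w : Omega) : nat :=
  (\sum_(1 <= tau < t.+1) (phi tau k w == i))%N.

Definition obs_count (i : 'I_N) (k : 'I_K) (t : nat) (w : Omega) : nat :=
  (\sum_(1 <= tau < t.+1) \sum_(j < K) (phi tau j w == i) * I tau k j w)%N.

Definition obs_sum (i : 'I_N) (k : 'I_K) (t : nat) (w : Omega) : R :=
  \sum_(1 <= tau < t.+1) \sum_(j < K)
    X tau j i w * (phi tau j w == i)%:R * (I tau k j w)%:R.

Definition obs_mean (i : 'I_N) (k : 'I_K) (t : nat) (w : Omega) : R :=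
  obs_sum i k t w / (obs_count i k t w)%:R.

(* An option of which agent k has no observation has index +oo: it is tried
   before any observed option. *)
Definition ucb_index (sigma : 'I_N -> R) (a : 'I_K -> R) (xi : R)
    (i : 'I_N) (k : 'I_K) (t : nat) (w : Omega) : \bar R :=
  if obs_count i k t w == 0%N then +oo%E
  else (obs_mean i k t w
        + sigma i * Num.sqrt (2 * (1 + a k) * (xi + 1) * ln t%:R
                              / (obs_count i k t w)%:R))%:E.

(* Events known when the draws of time t.+1 are made: draws and communications
   up to time t, and decisions up to time t.+1. *)
Definition history_gen (t : nat) : set (set Omega) :=
  [set A | exists s j i (B : set (measurableTypeR R)),
     [/\ (1 <= s <= t)%N, measurable B & A = X s j i @^-1` B]] `|`
  [set A | exists s k j, (1 <= s <= t)%N /\ A = [set w | I s k j w]] `|`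
  [set A | exists s k i, (1 <= s <= t.+1)%N /\ A = [set w | phi s k w = i]].

Definition history (t : nat) : set (set Omega) := <<s history_gen t >>.

End Run.

(* T steps of the distributed bandit problem on the graph e, with broadcasting
   probability p and arms of laws nu, under the heterogeneous sampling rules.
   Ties between indices may be broken arbitrarily, also at random, but without
   using draws or communications that have not happened yet. *)
Record bandit_run (R : realType) (K m N T : nat) (e : rel 'I_K) (p xi : R)
    (nu : 'I_N -> probability (measurableTypeR R) R) (sigma : 'I_N -> R)
    (d : measure_display) (Omega : measurableType d) (P : probability Omega R)
    (X : nat -> 'I_K -> 'I_N -> {RV P >-> R})
    (I : nat -> 'I_K -> 'I_K -> Omega -> bool)
    (phi : nat -> 'I_K -> Omega -> 'I_N) : Prop := {
  run_meas_phi : forall t k i, (1 <= t <= T)%N ->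
    measurable [set w | phi t k w = i];
  run_meas_link : forall t k j, (1 <= t <= T)%N ->
    measurable [set w | I t k j w];
  run_law : forall t k i (B : set (measurableTypeR R)), (1 <= t <= T)%N ->
    measurable B -> P (X t k i @^-1` B) = nu i B;
  run_link_self : forall t k w, (1 <= t <= T)%N -> I t k k w;
  run_link : forall t (k j : 'I_K), (1 <= t <= T)%N -> k != j ->
    'E_P[fun w => (I t k j w)%:R]%E = (if e k j then p else 0)%:E;
  (* For each t < T, the history, the communication pattern at time t.+1 and
     the individual draws of time t.+1 are mutually independent. No assumption
     is made on the joint law of the links of one time step. *)
  run_indep : forall t, (t < T)%N ->
    forall (A : set Omega) (L : 'I_K -> 'I_K -> bool)
           (B : 'I_K -> 'I_N -> set (measurableTypeR R)),
    history X I phi t A -> (forall j i, measurable (B j i)) ->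
    P (A `&` [set w | forall k j, I t.+1 k j w = L k j] `&`
       [set w | forall j i, B j i (X t.+1 j i w)]) =
    (P A * P [set w | forall k j, I t.+1 k j w = L k j]%classic *
     \prod_(j < K) \prod_(i < N) P (X t.+1 j i @^-1` B j i))%E;
  run_rule : forall t k w i, (t < T)%N ->
    (ucb_index X I phi sigma (explore_coef m e p) xi i k t w <=
     ucb_index X I phi sigma (explore_coef m e p) xi (phi t.+1 k w) k t w)%E
}.

Definition group_regret (R : realType) (K N : nat) (d : measure_display)
    (Omega : measurableType d) (P : probability Omega R)
    (phi : nat -> 'I_K -> Omega -> 'I_N) (Delta : 'I_N -> R) (t : nat) : \bar R :=
  (\sum_(i < N) \sum_(k < K)
     (Delta i)%:E * 'E_P[fun w => (own_count phi i k t w)%:R])%E.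

Definition c1 (R : realType) (K m : nat) (alpha p : R) : R :=
  K%:R - m%:R + m%:R * (1 + alpha) / (1 + p * (m%:R - 1))
                * Num.max (1 - p * ((K%:R - m%:R) / m%:R)) 0.

(* Main.v *)
(* The coefficient 8 of the log T term is four times the asymptotically needed 2,
   and the remaining term can be made to dominate any constant depending on
   K, m, p, xi by choosing zeta close to 1; so crude counting suffices.
   A pull of a suboptimal arm i by agent k falls into one of three classes.
   - Agent k has made at most
       l_k = 2 sigma_i^2 (1 + alpha_k) (xi + 1) log T / (9 Delta_i / 10)^2
     observations of i.
   - The mean of i is overestimated by Delta_i / 10: as each pull adds an
     observation, an exponential supermartingale with a small extra drift bounds
     the expected number of such pulls by O(sigma_i^2 / Delta_i^2), whatever T.
     This is absorbed by the slack in the log T term once log T >= 400 K.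
   - The mean of the optimal arm is underestimated at time t: a union bound over
     the at most K t possible numbers of observations gives probability
     O(t^(- xi)), which is summable.
   If K > m, then K - m >= m and adding up the l_k is enough. If K = m, the
   graph is complete; when p (m - 1) > 2, the agents must be coupled through
   communication, and a second exponential supermartingale shows that an agent
   rarely has observed less than 3 p / 4 times the total number of pulls of i. *)
Require Import Defs.
From HB Require Import structures.
From mathcomp Require Import all_boot all_order all_algebra.
From mathcomp Require Import all_classical all_reals all_analysis.
From mathcomp Require Import measurable_realfun ring lra.
Import Order.TTheory GRing.Theory Num.Theory.
Import numFieldNormedType.Exports.

Set Implicit Arguments.
Unset Strict Implicit.
Unset Printing Implicit Defensive.

Local Open Scope classical_set_scope.
Local Open Scope ring_scope.

Section Expectation.
Context (R : realType) (d : measure_display) (Omega : measurableType d)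
  (P : probability Omega R).
Implicit Types f g : Omega -> R.

Lemma eq_expectation f g : f =1 g -> ('E_P[f] = 'E_P[g])%E.
Proof. by move=> /funext ->. Qed.

Lemma ge0_expectationD f g :
  measurable_fun setT f -> measurable_fun setT g ->
  (forall w, 0 <= f w) -> (forall w, 0 <= g w) ->
  ('E_P[fun w => (f w + g w)%R] = 'E_P[f] + 'E_P[g])%E.
Proof.
move=> mf mg f0 g0; rewrite unlock -ge0_integralD//.
- by move=> w _; rewrite lee_fin.
- exact/measurable_EFinP.
- by move=> w _; rewrite lee_fin.
- exact/measurable_EFinP.
Qed.

Lemma ge0_expectation_sum (J : Type) (s : seq J) (f : J -> Omega -> R) :
  (forall j, measurable_fun setT (f j)) -> (forall j w, 0 <= f j w) ->
  ('E_P[fun w => \sum_(j <- s) f j w]%R = \sum_(j <- s) 'E_P[f j])%E.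
Proof.
move=> mf f0; rewrite unlock -ge0_integral_sum//.
- by apply: eq_integral => w _; rewrite -sumEFin.
- by move=> j; exact/measurable_EFinP.
- by move=> j w _; rewrite lee_fin.
Qed.

Lemma measurable_sum_nat (f : nat -> Omega -> R) (n : nat) :
  (forall t, (t < n)%N -> measurable_fun setT (f t)) ->
  measurable_fun setT (fun w => \sum_(0 <= t < n) f t w).
Proof.
move=> mf; rewrite (_ : (fun w => _) = (fun w => \sum_(t < n) f t w)).
  by apply: measurable_sum => t; exact: mf.
by apply/funext => w; rewrite big_mkord.
Qed.

Lemma ge0_expectation_sum_nat (f : nat -> Omega -> R) (n : nat) :
  (forall t, (t < n)%N -> measurable_fun setT (f t)) ->
  (forall t w, 0 <= f t w) ->
  ('E_P[fun w => (\sum_(0 <= t < n) f t w)%R] = \sum_(0 <= t < n) 'E_P[f t])%E.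
Proof.
move=> mf f0; rewrite big_mkord -ge0_expectation_sum//.
  by apply: eq_expectation => w; rewrite big_mkord.
by move=> t; exact: mf.
Qed.

Lemma ge0_expectationZl (c : R) f :
  measurable_fun setT f -> (forall w, 0 <= f w) -> 0 <= c ->
  ('E_P[fun w => (c * f w)%R] = c%:E * 'E_P[f])%E.
Proof.
move=> mf f0 c0; rewrite unlock -ge0_integralZl_EFin//.
- by move=> w _; rewrite lee_fin.
- exact/measurable_EFinP.
Qed.

Lemma ge0_le_expectation f g :
  measurable_fun setT f -> measurable_fun setT g ->
  (forall w, 0 <= f w) -> (forall w, f w <= g w) ->
  ('E_P[f] <= 'E_P[g])%E.
Proof.
move=> mf mg f0 fg; rewrite unlock; apply: ge0_le_integral => //.
- by move=> w _; rewrite lee_fin.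
- exact/measurable_EFinP.
- exact/measurable_EFinP.
- by move=> w _; rewrite lee_fin.
Qed.

Import HBNNSimple.

(* It suffices to test a product formula on indicator functions. *)
Lemma expectation_mul_ext d' (T' : measurableType d') (X : Omega -> T')
    (W : Omega -> R) (v : R) (f : T' -> R) :
  measurable_fun setT X -> measurable_fun setT W -> (forall w, 0 <= W w) ->
  (forall B, measurable B ->
     'E_P[fun w => (W w * \1_B (X w))%R]%E = (v%:E * P (X @^-1` B))%E) ->
  measurable_fun setT f -> (forall x, 0 <= f x) ->
  ('E_P[fun w => (W w * f (X w))%R] = v%:E * 'E_P[fun w => f (X w)])%E.
Proof.
move=> mX mW W0 H mf f0.
have mef : measurable_fun setT (EFin \o f) by exact/measurable_EFinP.
pose g := nnsfun_approx measurableT mef.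
have cvg_g x : EFin \o g ^~ x @ \oo --> (f x)%:E.
  by apply: cvg_nnsfun_approx => // y _; rewrite lee_fin.
have nd_g x n m : (n <= m)%N -> g n x <= g m x.
  by move=> nm; apply/lefP/nd_nnsfun_approx.
have mgX n : measurable_fun setT (fun w => g n (X w)).
  by apply: measurableT_comp => //.
have simple n : ('E_P[fun w => (W w * g n (X w))%R] =
                 v%:E * 'E_P[fun w => g n (X w)])%E.
  pose s := fset_set (range (g n)).
  pose y (i : 'I_(size (finmap.enum_fset s))) := (finmap.enum_fset s)`_i.
  pose B i := g n @^-1` [set y i].
  have mB i : measurable (B i) by rewrite /B -[X in measurable X]setTI; exact: measurable_funP.
  have y0 i : 0 <= y i.
    have : y i \in finmap.enum_fset s by apply: mem_nth.
    by rewrite in_fset_set// inE => -[x _ <-].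
  have mXB i : measurable_fun setT (fun w => \1_(B i) (X w) : R).
    by apply: measurableT_comp => //; exact: measurable_indic.
  have i0 i w : 0 <= \1_(B i) (X w) :> R by rewrite indicE.
  have gE w : g n (X w) = \sum_i y i * \1_(B i) (X w) by rewrite fimfunEord.
  have -> : ('E_P[fun w => (W w * g n (X w))%R] =
            'E_P[fun w => (\sum_i y i * (W w * \1_(B i) (X w)))%R])%E.
    apply: eq_expectation => w; rewrite gE mulr_sumr; apply: eq_bigr => i _.
    by rewrite mulrCA.
  rewrite (eq_expectation gE) !ge0_expectation_sum.
  - rewrite ge0_sume_distrr; last first.
      by move=> i _; apply: expectation_ge0 => w; rewrite mulr_ge0.
    apply: eq_bigr => i _.
    rewrite !ge0_expectationZl// ?H//.
    + rewrite muleCA; congr (_ * (_ * _))%E.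
      have -> : (fun w => \1_(B i) (X w) : R) = \1_(X @^-1` B i).
        by apply/funext => w; rewrite !indicE; congr (_%:R); apply/idP/idP; rewrite !inE.
      rewrite expectation_indic// -[X in measurable X]setTI; exact: mX.
    + exact: measurable_funM.
    + by move=> w; rewrite mulr_ge0.
  - by move=> i; apply: measurable_funM.
  - by move=> i w; rewrite mulr_ge0.
  - by move=> i; do 2?apply: measurable_funM.
  - by move=> i w; rewrite !mulr_ge0.
have lim1 : ('E_P[fun w => g n (X w)] @[n --> \oo] --> 'E_P[fun w => f (X w)])%E.
  rewrite unlock.
  have -> : (\int[P]_w (f (X w))%:E = \int[P]_w limn (fun n => (g n (X w))%:E))%E.
    by apply: eq_integral => w _; apply/esym/cvg_lim => //; exact: cvg_g.
  apply: cvg_monotone_convergence => //.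
  - by move=> n; exact/measurable_EFinP.
  - by move=> n w _; rewrite lee_fin.
  - by move=> w _ n m nm; rewrite lee_fin nd_g.
have lim2 : ('E_P[fun w => (W w * g n (X w))%R] @[n --> \oo] -->
            'E_P[fun w => (W w * f (X w))%R])%E.
  rewrite unlock.
  have -> : (\int[P]_w (W w * f (X w))%:E =
             \int[P]_w limn (fun n => (W w * g n (X w))%:E))%E.
    apply: eq_integral => w _; apply/esym/cvg_lim => //.
    under eq_fun do rewrite EFinM.
    by rewrite EFinM; apply: cvgeZl => //; exact: cvg_g.
  apply: cvg_monotone_convergence => //.
  - by move=> n; apply/measurable_EFinP; exact: measurable_funM.
  - by move=> n w _; rewrite lee_fin mulr_ge0.
  - by move=> w _ n m nm; rewrite lee_fin ler_wpM2l// nd_g.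
apply: (cvg_unique _ lim2) => //.
rewrite /= (funext simple).
exact: cvgeZl.
Qed.

End Expectation.

Lemma expectation_mul_prod (R : realType) (d : measure_display)
    (Omega : measurableType d) (P : probability Omega R) (n : nat)
    (U : Omega -> R) (u : R) (Y : 'I_n -> Omega -> R) :
  measurable_fun setT U -> (forall w, 0 <= U w) ->
  (forall j, measurable_fun setT (Y j)) ->
  (forall B : 'I_n -> set (measurableTypeR R), (forall j, measurable (B j)) ->
     'E_P[fun w => (U w * \prod_j \1_(B j) (Y j w))%R]%E =
     (u%:E * \prod_j P (Y j @^-1` B j))%E) ->
  forall (f : 'I_n -> R -> R) (v : 'I_n -> R),
  (forall j, measurable_fun setT (f j)) -> (forall j x, 0 <= f j x) ->
  (forall j, 'E_P[fun w => f j (Y j w)]%E = (v j)%:E) ->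
  'E_P[fun w => (U w * \prod_j f j (Y j w))%R]%E = (u * \prod_j v j)%:E.
Proof.
move=> mU U0 mY H f v mf f0 fv.
have mYB j (B : set (measurableTypeR R)) : measurable B ->
    measurable (Y j @^-1` B).
  by move=> mB; rewrite -[X in measurable X]setTI; exact: mY.
have indE j (B : set (measurableTypeR R)) :
    (fun w => \1_B (Y j w) : R) = \1_(Y j @^-1` B).
  by apply/funext => w; rewrite !indicE; congr (_%:R); apply/idP/idP; rewrite !inE.
suff : forall r (f : 'I_n -> R -> R) (v : 'I_n -> R), (forall j, measurable_fun setT (f j)) ->
    (forall j x, 0 <= f j x) ->
    (forall j, 'E_P[fun w => f j (Y j w)]%E = (v j)%:E) ->
    (forall j : 'I_n, (r <= j)%N -> exists B : set (measurableTypeR R),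
      measurable B /\ f j = \1_B) ->
    'E_P[fun w => (U w * \prod_j f j (Y j w))%R]%E = (u * \prod_j v j)%:E.
  by move=> /(_ n f v mf f0 fv); apply => j; rewrite leqNgt ltn_ord.
elim=> [|r IH] {mf f0 fv}f {}v mf f0 fv ind.
  have {}ind j := ind j (leq0n _).
  have [B HB] := choice ind.
  have -> : (fun w => U w * \prod_j f j (Y j w)) =
            (fun w => U w * \prod_j \1_(B j) (Y j w)).
    by apply/funext => w; congr (_ * _); apply: eq_bigr => j _; rewrite (HB j).2.
  have mB j : measurable (B j : set (measurableTypeR R)) by have [] := HB j.
  rewrite H; last exact: mB.
  rewrite EFinM -prodEFin; congr (_ * _)%E; apply: eq_bigr => j _.
  by rewrite -fv (HB j).2 indE expectation_indic//; apply: mYB; exact: mB.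
have [rn|nr] := ltnP r n; last first.
  by apply: IH => // j rj; move: (ltn_ord j); rewrite ltnNge (leq_trans nr).
pose j0 := Ordinal rn.
pose W w := U w * \prod_(j | j != j0) f j (Y j w).
have WE w : U w * \prod_j f j (Y j w) = W w * f j0 (Y j0 w).
  by rewrite (bigD1 j0)//= /W mulrCA mulrC.
have mfY j : measurable_fun setT (fun w => f j (Y j w)).
  exact: measurableT_comp.
have mW : measurable_fun setT W.
  apply: measurable_funM => //.
  have -> : (fun w => \prod_(j | j != j0) f j (Y j w)) =
    (fun w => \prod_(j <- [seq j <- index_enum 'I_n | j != j0]) f j (Y j w)).
    by apply/funext => w; rewrite big_filter.
  exact: measurable_prod.
have W0 w : 0 <= W w by rewrite mulr_ge0// prodr_ge0.
rewrite (eq_expectation P WE)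
  (@expectation_mul_ext _ _ _ P _ _ (Y j0) W (u * \prod_(j | j != j0) v j))//.
  by rewrite fv -EFinM [in RHS](bigD1 j0)//= mulrAC -mulrA.
move=> B mB.
pose f' j := if j == j0 then \1_B else f j.
pose v' j := if j == j0 then fine (P (Y j @^-1` B)) else v j.
have := IH f' v'.
have -> : (u * \prod_j v' j)%:E = ((u * \prod_(j | j != j0) v j)%:E * P (Y j0 @^-1` B))%E.
  rewrite (bigD1 j0)//= /v' eqxx mulrCA EFinM fineK ?fin_num_measure//; last exact: mYB.
  by rewrite muleC; congr (_%:E * _)%E; congr (_ * _); apply: eq_bigr => j /negPf ->.
have -> : (fun w => U w * \prod_j f' j (Y j w)) = (fun w => W w * \1_B (Y j0 w)).
  apply/funext => w; rewrite (bigD1 j0)//= /f' eqxx mulrCA mulrC; congr (_ * _ * _).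
  by apply: eq_bigr => j /negPf ->.
apply.
- by move=> j; rewrite /f'; case: ifP => // _; exact: measurable_indic.
- by move=> j x; rewrite /f'; case: ifP => // _; rewrite indicE.
- move=> j; rewrite /f' /v'; case: eqP => // _.
  by rewrite indE expectation_indic ?fineK ?fin_num_measure//; exact: mYB.
- move=> j rj; rewrite /f'; case: eqP => [_|jj0]; first by exists B.
  apply: ind; rewrite ltn_neqAle rj andbT; apply/eqP => rj'; apply: jj0.
  exact/val_inj.
Qed.

Lemma expectation_finType (R : realType) (d : measure_display)
    (Omega : measurableType d) (P : probability Omega R) (V : finType)
    (Y : Omega -> V) (G : V -> Omega -> R) :
  (forall v, measurable_fun setT (fun w => G v w * \1_[set w' | Y w' = v] w)) ->
  (forall v w, 0 <= G v w) ->
  ('E_P[fun w => G (Y w) w] =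
   \sum_v 'E_P[fun w => (G v w * \1_[set w' | Y w' = v] w)%R])%E.
Proof.
move=> mG G0; rewrite -ge0_expectation_sum//; last first.
  by move=> v w; rewrite mulr_ge0// indicE.
apply: eq_expectation => w; rewrite (bigD1 (Y w))//= indicE mem_set// mulr1.
rewrite big1 ?addr0// => v vY; rewrite indicE memNset ?mulr0//=.
by move=> /esym vE; rewrite vE eqxx in vY.
Qed.

(* V is a supermartingale that loses a fraction q of its mass whenever b holds. *)
Lemma potential_sum (R : realType) (d : measure_display)
    (Omega : measurableType d) (P : probability Omega R)
    (V : nat -> Omega -> R) (b : nat -> Omega -> bool) (q : R) (n : nat) :
  0 <= q <= 1 ->
  (forall t, (t <= n)%N -> measurable_fun setT (V t)) ->
  (forall t w, 0 <= V t w) ->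
  (forall t, (t < n)%N -> measurable_fun setT (fun w => (b t w)%:R : R)) ->
  ('E_P[V 0%N] <= 1)%E ->
  (forall t z, (t < n)%N -> 'E_P[V t]%E = z%:E ->
    ('E_P[V t.+1] <= 'E_P[fun w => (V t w * (1 - q * (b t w)%:R))%R])%E) ->
  ('E_P[V n] + q%:E * \sum_(0 <= t < n) 'E_P[fun w => (V t w * (b t w)%:R)%R]
    <= 1)%E.
Proof.
move=> /andP[q0 q1]; elim: n => [|n IH] mV V0 mb EV0 step.
  by rewrite big_nil mule0 adde0.
have {}IH := IH (fun t tn => mV t (leqW tn)) V0 (fun t tn => mb t (leqW tn)) EV0
  (fun t z tn => step t z (leqW tn)).
have mVb : measurable_fun setT (fun w => V n w * (b n w)%:R).
  by apply: measurable_funM; [exact: mV|exact: mb].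
have Vb0 w : 0 <= V n w * (b n w)%:R by rewrite mulr_ge0.
have S0 : (0 <= q%:E * \sum_(0 <= t < n) 'E_P[fun w => (V t w * (b t w)%:R)%R])%E.
  rewrite mule_ge0// sume_ge0// => t _; apply: expectation_ge0 => w.
  by rewrite mulr_ge0.
have fin : 'E_P[V n]%E = (fine 'E_P[V n])%:E.
  rewrite fineK// ge0_fin_numE ?expectation_ge0// (@le_lt_trans _ _ 1%E) ?ltry//.
  by apply: le_trans IH; rewrite leeDl.
have {}step := step n _ (ltnSn n) fin.
apply: le_trans IH; rewrite big_nat_recr//= ge0_muleDr//; last 2 first.
  by rewrite sume_ge0// => t _; apply: expectation_ge0 => w; rewrite mulr_ge0.
  exact: expectation_ge0.
rewrite addeCA [leRHS]addeC leeD2l//.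
have split w : V n w = V n w * (1 - q * (b n w)%:R) + q * (V n w * (b n w)%:R).
  by rewrite mulrBr mulr1 mulrCA subrK.
rewrite [leRHS](eq_expectation P split) ge0_expectationD.
- by rewrite ge0_expectationZl// leeD2r.
- apply: measurable_funM; first exact: mV.
  by apply: measurable_funB => //; apply: measurable_funM => //; exact: mb.
- exact: measurable_funM.
- move=> w; rewrite mulr_ge0// subr_ge0; case: (b n w) => /=; rewrite ?mulr1//.
  by rewrite mulr0.
- by move=> w; rewrite mulr_ge0.
Qed.

Lemma potential_sum_last (R : realType) (d : measure_display)
    (Omega : measurableType d) (P : probability Omega R)
    (V : nat -> Omega -> R) (b : nat -> Omega -> bool) (q : R) (n : nat) :
  0 <= q <= 1 ->
  (forall t, (t < n)%N -> measurable_fun setT (V t)) ->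
  (forall t w, 0 <= V t w) ->
  (forall t, (t < n)%N -> measurable_fun setT (fun w => (b t w)%:R : R)) ->
  ('E_P[V 0%N] <= 1)%E ->
  (forall t z, (t.+1 < n)%N -> 'E_P[V t]%E = z%:E ->
    ('E_P[V t.+1] <= 'E_P[fun w => (V t w * (1 - q * (b t w)%:R))%R])%E) ->
  (q%:E * \sum_(0 <= t < n) 'E_P[fun w => (V t w * (b t w)%:R)%R] <= 1)%E.
Proof.
case: n => [|n] q01 mV V0 mb EV0 step; first by rewrite big_nil mule0.
have /andP[q0 q1] := q01.
have := potential_sum q01 mV V0 (fun t tn => mb t (leqW tn)) EV0
  (fun t z tn => step t z tn).
apply: le_trans; rewrite big_nat_recr//= ge0_muleDr//; last 2 first.
  by rewrite sume_ge0// => t _; apply: expectation_ge0 => w; rewrite mulr_ge0.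
  by apply: expectation_ge0 => w; rewrite mulr_ge0.
have mVb : measurable_fun setT (fun w => V n w * (b n w)%:R).
  by apply: measurable_funM; [exact: mV|exact: mb].
have Vb0 w : 0 <= V n w * (b n w)%:R by rewrite mulr_ge0.
rewrite addeC leeD2r// -ge0_expectationZl//; apply: ge0_le_expectation => //.
- exact: measurable_funM.
- exact: mV.
- by move=> w; rewrite mulr_ge0.
- move=> w; case: (b n w); rewrite ?mulr1 ?mulr0//.
  by rewrite ler_piMl.
Qed.

Lemma ln_nat_ge0 (R : realType) (n : nat) : 0 <= ln n%:R :> R.
Proof. by case: n => [|n]; [rewrite ln0|rewrite ln_ge0// ler1n]. Qed.

Lemma ler_ln_nat (R : realType) (m n : nat) : (m <= n)%N -> ln m%:R <= ln n%:R :> R.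
Proof.
case: m => [|m] mn; first by rewrite ln0// ln_nat_ge0.
by rewrite ler_ln ?posrE ?ltr0n ?ler_nat// (leq_trans _ mn).
Qed.

Lemma sum_npow_le (R : realType) (xi : R) (n : nat) : 1 < xi ->
  \sum_(0 <= t < n) t%:R * expR (- ((xi + 1) * ln t%:R)) <= 1 + (xi - 1)^-1.
Proof.
move=> xi1; set b := (xi - 1)^-1.
have xb : 0 < xi - 1 by rewrite subr_gt0.
have b0 : 0 < b by rewrite invr_gt0.
have bE : b * (xi - 1) = 1 by rewrite mulVf// gt_eqF.
have term (t : nat) : (0 < t)%N ->
    t%:R * expR (- ((xi + 1) * ln t%:R)) = expR (- ((xi - 1) * ln t%:R)) / t%:R.
  move=> t0; have t0' : 0 < t%:R :> R by rewrite ltr0n.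
  have -> : - ((xi + 1) * ln t%:R) = - ((xi - 1) * ln t%:R) - ln t%:R - ln t%:R :> R by ring.
  by rewrite !expRD !expRN lnK ?posrE// !mulrA mulrC mulrA mulKr// unitfE gt_eqF.
have H k : \sum_(0 <= t < k.+2) t%:R * expR (- ((xi + 1) * ln t%:R)) <=
    1 + b - b * expR (- ((xi - 1) * ln k.+1%:R)).
  elim: k => [|k IH].
    by rewrite big_nat_recr// big_nat1 /= mul0r add0r ln1 !mulr0 oppr0 expR0 !mulr1 addrK.
  rewrite big_nat_recr//=; set S := \sum_(_ <= _ < _) _ in IH *.
  rewrite term//.
  set s := k.+1%:R in IH *; set t := k.+2%:R.
  have s0 : 0 < s :> R by rewrite ltr0n.
  have t0 : 0 < t :> R by rewrite ltr0n.
  have ts : t = s + 1 by rewrite /t -natr1.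
  have hln : t^-1 <= ln t - ln s.
    have := expR_ge1Dx (ln s - ln t); rewrite expRB !lnK ?posrE//.
    have -> : s / t = 1 - t^-1.
      by rewrite (_ : s = t - 1) ?mulrBl ?divff ?mul1r ?gt_eqF// ts addrK.
    by set u := t^-1; clearbody u; move: (ln s) (ln t) => x y; lra.
  have he : expR (- ((xi - 1) * ln t)) * (1 + (xi - 1) / t) <=
            expR (- ((xi - 1) * ln s)).
    have -> : - ((xi - 1) * ln s) = - ((xi - 1) * ln t) + (xi - 1) * (ln t - ln s) by ring.
    rewrite expRD ler_wpM2l ?expR_ge0//; apply: le_trans (expR_ge1Dx _).
    by rewrite lerD2l ler_wpM2l// ltW.
  have := ler_wpM2l (ltW b0) he.
  set et := expR _ in he *; set es := expR _ in IH he *.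
  have -> : b * (et * (1 + (xi - 1) / t)) = b * et + b * (xi - 1) * (et / t) by ring.
  rewrite bE mul1r; move: IH; move: (b * es) (b * et) (et / t) => x y z; clearbody S; lra.
case: n => [|[|k]].
- by rewrite big_nil; lra.
- by rewrite big_nat1 mul0r; lra.
- apply: le_trans (H k) _; rewrite lerBlDr lerDl.
  by rewrite mulr_ge0 ?expR_ge0// ltW.
Qed.

Section RunTheory.
Context (R : realType) (K m N T : nat) (e : rel 'I_K) (p xi : R)
  (nu : 'I_N -> probability (measurableTypeR R) R) (sigma : 'I_N -> R)
  (d : measure_display) (Omega : measurableType d) (P : probability Omega R)
  (X : nat -> 'I_K -> 'I_N -> {RV P >-> R})
  (I : nat -> 'I_K -> 'I_K -> Omega -> bool)
  (phi : nat -> 'I_K -> Omega -> 'I_N).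
Hypothesis run : bandit_run m T e p xi nu sigma X I phi.

Definition past (t : nat) : measurableType _ :=
  g_sigma_algebraType (history_gen (fun t k i => X t k i : Omega -> R) I phi t).

Definition past_measurable (t : nat) (f : Omega -> R) :=
  measurable_fun [set: past t] f.

Lemma history_measurable t A : (t < T)%N -> history X I phi t A -> measurable A.
Proof.
move=> tT; apply: smallest_sub; first exact: sigma_algebra_measurable.
move=> B [[]|].
- move=> [s [j [i [C [st mC ->]]]]].
  by rewrite -[X in measurable X]setTI; exact: measurable_funP.
- move=> [s [k [j [/andP[s0 st] ->]]]].
  by apply: (run_meas_link run); rewrite s0 (leq_trans st)// ltnW.
- move=> [s [k [i [/andP[s0 st] ->]]]].
  by apply: (run_meas_phi run); rewrite s0 (leq_trans st).
Qed.

Lemma past_measurable_fun t f : (t < T)%N -> past_measurable t f ->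
  measurable_fun [set: Omega] f.
Proof.
move=> tT mf _ B mB; apply: (history_measurable tT).
exact: (mf measurableT B mB).
Qed.

Lemma past_measurable_id t : (t < T)%N ->
  measurable_fun [set: Omega] (id : Omega -> past t).
Proof. by move=> tT _ B mB; rewrite setTI; exact: (history_measurable tT). Qed.

Lemma past_reward t s j i : (1 <= s <= t)%N -> past_measurable t (X s j i).
Proof.
move=> st _ B mB; rewrite setTI; apply: sub_sigma_algebra.
by left; left; exists s, j, i, B.
Qed.

Lemma past_link t s k j : (1 <= s <= t)%N ->
  past_measurable t (fun w => (I s k j w)%:R).
Proof.
move=> st; have -> : (fun w => (I s k j w)%:R) =
    \1_([set w | I s k j w] : set (past t)) :> (Omega -> R).
  apply/funext => w; rewrite indicE; have [h|/negP h] := boolP (I s k j w).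
    by rewrite mem_set.
  by rewrite memNset.
apply: measurable_indic; apply: sub_sigma_algebra.
by left; right; exists s, k, j.
Qed.

Lemma past_choice t s k i : (1 <= s <= t.+1)%N ->
  past_measurable t (fun w => (phi s k w == i)%:R).
Proof.
move=> st; have -> : (fun w => (phi s k w == i)%:R) =
    \1_([set w | phi s k w = i] : set (past t)) :> (Omega -> R).
  apply/funext => w; rewrite indicE; have [h|/eqP h] := eqVneq (phi s k w) i.
    by rewrite mem_set.
  by rewrite memNset.
apply: measurable_indic; apply: sub_sigma_algebra.
by right; exists s, k, i.
Qed.

Lemma past_sum_nat t (F : nat -> Omega -> R) :
  (forall s, (1 <= s <= t)%N -> past_measurable t (F s)) ->
  past_measurable t (fun w => \sum_(1 <= s < t.+1) F s w).
Proof.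
move=> mF; have -> : (fun w => \sum_(1 <= s < t.+1) F s w) =
    (fun w => \sum_(1 <= s < t.+1) if (1 <= s <= t)%N then F s w else 0).
  by apply/funext => w; apply: eq_big_nat => s /= ->.
apply: measurable_sum => s; case: (1 <= s <= t)%N (mF s) => [|_]; first exact.
exact: measurable_cst.
Qed.

Lemma past_obs_count t i k :
  past_measurable t (fun w => (obs_count I phi i k t w)%:R).
Proof.
have -> : (fun w => (obs_count I phi i k t w)%:R) = (fun w =>
    \sum_(1 <= s < t.+1) \sum_(j < K)
       (phi s j w == i)%:R * (I s k j w)%:R) :> (Omega -> R).
  apply/funext => w; rewrite /obs_count natr_sum; apply: eq_bigr => s _.
  by rewrite natr_sum; apply: eq_bigr => j _; rewrite natrM.
apply: past_sum_nat => s /andP[s0 st]; apply: measurable_sum => j.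
apply: measurable_funM; first by apply: past_choice; rewrite s0 leqW.
by apply: past_link; rewrite s0.
Qed.

Lemma past_obs_sum t i k : past_measurable t (obs_sum X I phi i k t).
Proof.
apply: past_sum_nat => s /andP[s0 st]; apply: measurable_sum => j.
apply: measurable_funM; last by apply: past_link; rewrite s0.
apply: measurable_funM; last by apply: past_choice; rewrite s0 leqW.
by apply: past_reward; rewrite s0.
Qed.

Definition choosers (t : nat) (i : 'I_N) (w : Omega) : {ffun 'I_K -> bool} :=
  [ffun j => phi t j w == i].

Definition links (t : nat) (w : Omega) : {ffun 'I_K * 'I_K -> bool} :=
  [ffun kj => I t kj.1 kj.2 w].

Lemma past_choosers t i D :
  measurable ([set w | choosers t.+1 i w = D] : set (past t)).
Proof.
have -> : [set w | choosers t.+1 i w = D] =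
    \bigcap_(j in [set: 'I_K]) [set w | (phi t.+1 j w == i) = D j].
  apply/seteqP; split=> w /= => [<- j _|h]; first by rewrite ffunE.
  by apply/ffunP => j; rewrite ffunE; exact: h.
apply: fin_bigcap_measurable => // j _.
have mj : measurable ([set w | phi t.+1 j w = i] : set (past t)).
  apply: sub_sigma_algebra; right; exists t.+1, j, i; split=> //.
  by rewrite leqnn.
case: (D j).
  by rewrite (_ : [set w | _] = [set w | phi t.+1 j w = i])//; apply/seteqP;
    split=> w /= /eqP.
rewrite (_ : [set w | _] = ~` [set w | phi t.+1 j w = i]); first exact: measurableC.
by apply/seteqP; split=> w /=; [move/negbT/eqP|move=> h; exact/negbTE/eqP].
Qed.

Lemma measurable_links t L : (t < T)%N ->
  measurable [set w | links t.+1 w = L].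
Proof.
move=> tT; have -> : [set w | links t.+1 w = L] =
    \bigcap_(k in [set: 'I_K * 'I_K]) [set w | I t.+1 k.1 k.2 w = L k].
  apply/seteqP; split=> w /= => [<- j _|h]; first by rewrite ffunE.
  by apply/ffunP => j; rewrite ffunE; exact: h.
apply: fin_bigcap_measurable => // k _.
have mk : measurable [set w | I t.+1 k.1 k.2 w] by exact: (run_meas_link run).
case: (L k) => //.
rewrite (_ : [set w | _] = ~` [set w | I t.+1 k.1 k.2 w]); first exact: measurableC.
by apply/seteqP; split=> w /=; [move/negbT/negP|move=> h; exact/negbTE/negP].
Qed.

Definition link_prob (t : nat) (L : {ffun 'I_K * 'I_K -> bool}) : R :=
  fine (P [set w | links t w = L]).

Lemma link_probE t L : (t < T)%N ->
  P [set w | links t.+1 w = L] = (link_prob t.+1 L)%:E.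
Proof.
by move=> tT; rewrite fineK// fin_num_measure//; exact: measurable_links.
Qed.

Lemma reward_indep t i (Z : Omega -> R) z L (f : 'I_K -> R -> R) v :
  (t < T)%N -> past_measurable t Z -> (forall w, 0 <= Z w) ->
  'E_P[Z]%E = z%:E ->
  (forall j, measurable_fun setT (f j)) -> (forall j x, 0 <= f j x) ->
  (forall j, 'E_P[fun w => f j (X t.+1 j i w)]%E = (v j)%:E) ->
  'E_P[fun w => (Z w * \1_[set w' | links t.+1 w' = L] w *
                 \prod_j f j (X t.+1 j i w))%R]%E =
  (z * link_prob t.+1 L * \prod_j v j)%:E.
Proof.
move=> tT mZ Z0 Zz mf f0 fv.
set LS := [set w' | links t.+1 w' = L].
have mLS : measurable LS by exact: measurable_links.
have mfX j : measurable_fun setT (fun w => f j (X t.+1 j i w)).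
  exact: measurableT_comp.
pose W w := \1_LS w * \prod_j f j (X t.+1 j i w).
have mW : measurable_fun setT W.
  by apply: measurable_funM; [exact: measurable_indic|exact: measurable_prod].
have W0 w : 0 <= W w by rewrite mulr_ge0// ?indicE// prodr_ge0.
have WZ w : Z w * \1_LS w * \prod_j f j (X t.+1 j i w) = W w * Z (id w).
  by rewrite -mulrA mulrC.
rewrite (eq_expectation P WZ) (@expectation_mul_ext _ _ _ P _ (past t) id W
    (link_prob t.+1 L * \prod_j v j) Z)//.
- by rewrite Zz -EFinM mulrC mulrA.
- exact: past_measurable_id.
move=> B mB.
have {}mB' : measurable (B : set Omega) by exact: history_measurable tT mB.
pose U w : R := \1_(B `&` LS) w.
have WU w : W w * \1_B w = U w * \prod_j f j (X t.+1 j i w).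
  by rewrite /U indicI mulrC mulrA.
rewrite (eq_expectation P WU).
transitivity ((fine (P B) * link_prob t.+1 L * \prod_j v j)%:E); last first.
  by rewrite -mulrA EFinM fineK ?fin_num_measure// muleC.
apply: (@expectation_mul_prod _ _ _ P K U
  (fine (P B) * link_prob t.+1 L) (fun j => X t.+1 j i)) => //.
- by apply: measurable_indic; exact: measurableI.
- move=> C mC.
  have -> : (fun w => U w * \prod_j \1_(C j) (X t.+1 j i w)) =
      \1_(B `&` LS `&` [set w | forall j, C j (X t.+1 j i w)]).
    apply/funext => w; rewrite indicI; congr (_ * _).
    rewrite indicE; have [h|h] := pselect (forall j, C j (X t.+1 j i w)).
      rewrite mem_set// big1// => j _; rewrite indicE mem_set//; exact: h.
    rewrite memNset//; move/existsNP : h => [j h].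
    by rewrite (bigD1 j)//= indicE memNset// mul0r.
  have mXC : measurable [set w | forall j, C j (X t.+1 j i w)].
    have -> : [set w | forall j, C j (X t.+1 j i w)] =
        \bigcap_(j in [set: 'I_K]) (X t.+1 j i @^-1` C j).
      by apply/seteqP; split=> w h j; [move=> _|]; exact: (h j).
    apply: fin_bigcap_measurable => // j _.
    have mXj : measurable_fun setT (X t.+1 j i) by [].
    have := mXj measurableT _ (mC j).
    by rewrite setTI.
  rewrite expectation_indic; last by apply: measurableI => //; exact: measurableI.
  pose C' j i' := if i' == i then C j else setT.
  have mC' j i' : measurable (C' j i' : set (measurableTypeR R)).
    by rewrite /C'; case: ifP.
  have := (run_indep run) t tT B (fun k j => L (k, j)) C' mB mC'.
  have -> : [set w | forall k j, I t.+1 k j w = L (k, j)] = LS.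
    apply/seteqP; split=> w /= => [h|<- k j]; last by rewrite ffunE.
    by apply/ffunP => -[k j]; rewrite ffunE h.
  have -> : [set w | forall j i0, C' j i0 (X t.+1 j i0 w)] =
            [set w | forall j, C j (X t.+1 j i w)].
    apply/seteqP; split=> w /= h j; first by have := h j i; rewrite /C' eqxx.
    by move=> i'; rewrite /C'; case: eqP => // ->.
  move=> ->; rewrite EFinM -link_probE// fineK ?fin_num_measure//; congr (_ * _)%E.
  apply: eq_bigr => j _.
  rewrite (bigD1 i)//= /C' eqxx big1 ?mule1// => i' /negPf ->.
  by rewrite preimage_setT probability_setT.
Qed.

Lemma link_prob_ge0 t L : 0 <= link_prob t L.
Proof. by rewrite fine_ge0. Qed.

Lemma expectation_links t (g : {ffun 'I_K * 'I_K -> bool} -> R) :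
  (t < T)%N -> (forall L, 0 <= g L) ->
  'E_P[fun w => g (links t.+1 w)]%E = (\sum_L link_prob t.+1 L * g L)%:E.
Proof.
move=> tT g0; rewrite (@expectation_finType _ _ _ _ _ _ (fun L _ => g L))//.
  rewrite -sumEFin; apply: eq_bigr => L _.
  have mL := measurable_links L tT.
  rewrite ge0_expectationZl// ?expectation_indic//.
  by rewrite link_probE// -EFinM mulrC.
move=> L; apply: measurable_funM => //; apply: measurable_indic.
exact: measurable_links.
Qed.

Lemma link_prob_sum1 t : (t < T)%N -> \sum_L link_prob t.+1 L = 1.
Proof.
move=> tT; have := @expectation_links t (fun=> 1) tT (fun=> ler01).
rewrite expectation_cst => -[->]; apply: eq_bigr => L _; by rewrite mulr1.
Qed.

Lemma link_prob_mean t k j : (t < T)%N -> k != j ->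
  \sum_L link_prob t.+1 L * (L (k, j))%:R = if e k j then p else 0.
Proof.
move=> tT kj; apply: EFin_inj.
have tT' : (1 <= t.+1 <= T)%N by [].
rewrite -(run_link run tT' kj) -(@expectation_links _ (fun L => (L (k, j))%:R))//.
by apply: eq_expectation => w; rewrite ffunE.
Qed.

Lemma link_prob_self t k (L : {ffun 'I_K * 'I_K -> bool}) : (t < T)%N -> ~~ L (k, k) -> link_prob t.+1 L = 0.
Proof.
move=> tT Lk; rewrite /link_prob (_ : [set w | _] = set0) ?measure0//.
apply/seteqP; split=> w //= wL; move: Lk; rewrite -wL ffunE.
by rewrite (run_link_self run).
Qed.

Definition choosers_mass t i (Z : Omega -> R) (D : {ffun 'I_K -> bool}) : R :=
  fine 'E_P[fun w => (Z w * \1_[set w' | choosers t i w' = D] w)%R].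

Section Step.
Variables (t : nat) (i : 'I_N) (Z : Omega -> R) (z : R).
Hypotheses (tT : (t < T)%N) (mZ : past_measurable t Z)
  (Z0 : forall w, 0 <= Z w) (Zz : 'E_P[Z]%E = z%:E).

Let mZ1 (D : {ffun 'I_K -> bool}) : past_measurable t
  (fun w => Z w * \1_[set w' | choosers t.+1 i w' = D] w).
Proof.
by apply: measurable_funM => //; apply: measurable_indic; exact: past_choosers.
Qed.

Let Z10 (D : {ffun 'I_K -> bool}) w : 0 <= Z w * \1_[set w' | choosers t.+1 i w' = D] w.
Proof. by rewrite mulr_ge0// indicE. Qed.

Let choosers_massE D :
  'E_P[fun w => (Z w * \1_[set w' | choosers t.+1 i w' = D] w)%R]%E =
  (choosers_mass t.+1 i Z D)%:E.
Proof.
rewrite fineK// ge0_fin_numE ?expectation_ge0//.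
rewrite (@le_lt_trans _ _ z%:E) ?ltry// -Zz.
apply: ge0_le_expectation => //.
- exact: past_measurable_fun tT (mZ1 D).
- exact: past_measurable_fun tT mZ.
- by move=> w; rewrite ler_piMr// indicE lern1 leq_b1.
Qed.

Lemma choosers_mass_ge0 D : 0 <= choosers_mass t.+1 i Z D.
Proof. by rewrite fine_ge0// expectation_ge0. Qed.

Lemma step_expectation (h : {ffun 'I_K -> bool} -> {ffun 'I_K * 'I_K -> bool} -> R)
    (f : {ffun 'I_K -> bool} -> {ffun 'I_K * 'I_K -> bool} -> 'I_K -> R -> R) v :
  (forall D L, 0 <= h D L) ->
  (forall D L j, measurable_fun setT (f D L j)) ->
  (forall D L j x, 0 <= f D L j x) ->
  (forall D L j, 'E_P[fun w => f D L j (X t.+1 j i w)]%E = (v D L j)%:E) ->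
  'E_P[fun w => (Z w * h (choosers t.+1 i w) (links t.+1 w) *
     \prod_j f (choosers t.+1 i w) (links t.+1 w) j (X t.+1 j i w))%R]%E =
  (\sum_D choosers_mass t.+1 i Z D *
    \sum_L link_prob t.+1 L * (h D L * \prod_j v D L j))%:E.
Proof.
move=> h0 mf f0 fv.
pose Y w := (choosers t.+1 i w, links t.+1 w).
pose G (DL : {ffun 'I_K -> bool} * {ffun 'I_K * 'I_K -> bool}) w :=
  Z w * h DL.1 DL.2 * \prod_j f DL.1 DL.2 j (X t.+1 j i w).
have G0 DL w : 0 <= G DL w by rewrite !mulr_ge0// prodr_ge0.
pose G1 D L w := Z w * \1_[set w' | choosers t.+1 i w' = D] w *
  \1_[set w' | links t.+1 w' = L] w * \prod_j f D L j (X t.+1 j i w).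
have GE DL w : G DL w * \1_[set w' | Y w' = DL] w = h DL.1 DL.2 * G1 DL.1 DL.2 w.
  have -> : [set w' | Y w' = DL] = [set w' | choosers t.+1 i w' = DL.1] `&`
      [set w' | links t.+1 w' = DL.2].
    apply/seteqP; split=> w' /=; first by move=> <-.
    by case: DL => D L [/= <- <-].
  rewrite indicI.
  rewrite /G /G1 -!mulrA [LHS]mulrCA; congr (_ * (_ * _)).
  by rewrite mulrC mulrA.
have mG1 D L : measurable_fun setT (G1 D L).
  apply: measurable_funM; last first.
    by apply: measurable_prod => j _; exact: measurableT_comp.
  apply: measurable_funM; first exact: past_measurable_fun tT (mZ1 D).
  by apply: measurable_indic; exact: measurable_links.
have G10 D L w : 0 <= G1 D L w.
  by rewrite !mulr_ge0// ?indicE// prodr_ge0.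
rewrite (@expectation_finType _ _ _ _ _ Y G)//; last first.
  by move=> DL; rewrite (funext (GE DL)); exact: measurable_funM.
transitivity (\sum_DL h DL.1 DL.2 * (choosers_mass t.+1 i Z DL.1 *
    link_prob t.+1 DL.2 * \prod_j v DL.1 DL.2 j))%:E.
  rewrite -sumEFin; apply: eq_bigr => DL _.
  rewrite (eq_expectation P (GE DL)) ge0_expectationZl// EFinM; congr (_ * _)%E.
  exact: reward_indep.
congr EFin.
rewrite -(pair_bigA _ (fun D L => h D L * (choosers_mass t.+1 i Z D *
    link_prob t.+1 L * \prod_j v D L j)))/=.
apply: eq_bigr => D _; rewrite mulr_sumr; apply: eq_bigr => L _.
by rewrite -!mulrA mulrCA; congr (_ * _); rewrite mulrCA.
Qed.

Lemma step_le (h : {ffun 'I_K -> bool} -> {ffun 'I_K * 'I_K -> bool} -> R)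
    (f : {ffun 'I_K -> bool} -> {ffun 'I_K * 'I_K -> bool} -> 'I_K -> R -> R) v
    (c : {ffun 'I_K -> bool} -> R) :
  (forall D L, 0 <= h D L) ->
  (forall D L j, measurable_fun setT (f D L j)) ->
  (forall D L j x, 0 <= f D L j x) ->
  (forall D L j, 'E_P[fun w => f D L j (X t.+1 j i w)]%E = (v D L j)%:E) ->
  (forall D, 0 <= c D) ->
  (forall D, \sum_L link_prob t.+1 L * (h D L * \prod_j v D L j) <= c D) ->
  ('E_P[fun w => (Z w * h (choosers t.+1 i w) (links t.+1 w) *
     \prod_j f (choosers t.+1 i w) (links t.+1 w) j (X t.+1 j i w))%R] <=
   'E_P[fun w => (Z w * c (choosers t.+1 i w))%R])%E.
Proof.
move=> h0 mf f0 fv c0 hc; rewrite (step_expectation h0 mf f0 fv).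
have -> : 'E_P[fun w => (Z w * c (choosers t.+1 i w))%R]%E =
    (\sum_D choosers_mass t.+1 i Z D * c D)%:E.
  have := @step_expectation (fun D _ => c D) (fun _ _ _ _ => 1) (fun _ _ _ => 1).
  rewrite (_ : (fun w => _ * \prod_j 1) = (fun w => Z w * c (choosers t.+1 i w))).
    move=> -> //; last by move=> *; exact: expectation_cst.
    congr EFin; apply: eq_bigr => D _; congr (_ * _).
    by rewrite -mulr_suml link_prob_sum1// mul1r big1// mulr1.
  by apply/funext => w; rewrite big1// mulr1.
rewrite lee_fin; apply: ler_sum => D _.
by rewrite ler_wpM2l// choosers_mass_ge0.
Qed.

End Step.

Lemma past_choosersP t i j : (t < T)%N ->
  measurable_fun [set: Omega] (fun w => (choosers t.+1 i w j)%:R : R).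
Proof.
move=> tT; apply: (@past_measurable_fun t) => //.
have -> : (fun w => (choosers t.+1 i w j)%:R : R) =
          (fun w => (phi t.+1 j w == i)%:R).
  by apply/funext => w; rewrite ffunE.
by apply: past_choice; rewrite ltnSn.
Qed.

Lemma obs_countS i k t w : obs_count I phi i k t.+1 w =
  (obs_count I phi i k t w +
   \sum_(j < K) choosers t.+1 i w j * links t.+1 w (k, j))%N.
Proof.
rewrite /obs_count big_nat_recr//=; congr addn; apply: eq_bigr => j _.
by rewrite !ffunE.
Qed.

Definition deviation (i : 'I_N) (k : 'I_K) (mu : R) (t : nat) (w : Omega) : R :=
  obs_sum X I phi i k t w - mu * (obs_count I phi i k t w)%:R.

Lemma deviationS i k mu t w : deviation i k mu t.+1 w = deviation i k mu t w +
  \sum_(j < K) (choosers t.+1 i w j * links t.+1 w (k, j))%:R *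
    (X t.+1 j i w - mu).
Proof.
rewrite /deviation obs_countS /obs_sum big_nat_recr//= natrD natr_sum mulrDr.
rewrite opprD addrACA; congr (_ + _); rewrite mulr_sumr -sumrB.
by apply: eq_bigr => j _; rewrite !ffunE natrM; ring.
Qed.

Definition reward_potential i k mu lam gam t w : R :=
  expR (lam * deviation i k mu t w - gam * (obs_count I phi i k t w)%:R).

Lemma past_reward_potential i k mu lam gam t :
  past_measurable t (reward_potential i k mu lam gam t).
Proof.
apply: measurableT_comp => //; apply: measurable_funB.
  apply: measurable_funM => //; apply: measurable_funB; first exact: past_obs_sum.
  by apply: measurable_funM => //; exact: past_obs_count.
by apply: measurable_funM => //; exact: past_obs_count.
Qed.

Section Reward.
Variables (i : 'I_N) (k : 'I_K) (mu lam gam : R).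
Hypothesis sg : sub_gaussian (nu i) mu (sigma i).
Hypothesis gamP : lam ^+ 2 * sigma i ^+ 2 / 2 <= gam.

Lemma reward_mgf t j : (1 <= t <= T)%N ->
  ('E_P[fun w => expR (lam * (X t j i w - mu) - gam)%R] <=
   (expR (lam ^+ 2 * sigma i ^+ 2 / 2 - gam))%:E)%E.
Proof.
move=> tT; pose g x : R := expR (lam * (x - mu)).
have mg : measurable_fun setT g.
  by apply: measurableT_comp => //; apply: measurable_funM => //; exact: measurable_funB.
have E w : expR (lam * (X t j i w - mu) - gam) = expR (- gam) * g (X t j i w).
  by rewrite expRD mulrC.
rewrite (eq_expectation P E) ge0_expectationZl ?expR_ge0//; last first.
- by move=> w; exact: expR_ge0.
- exact: measurableT_comp.
rewrite addrC expRD EFinM lee_wpmul2l// ?lee_fin ?expR_ge0//.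
apply: le_trans (sg.2 lam); rewrite unlock.
have mX : measurable_fun setT (X t j i : Omega -> measurableTypeR R).
  by move=> _ B mB; exact: (@measurable_funP _ _ _ _ _ (X t j i)).
have mg' : measurable_fun setT (EFin \o g : measurableTypeR R -> \bar R).
  by apply/measurable_EFinP => _ B mB; exact: mg.
have := @ge0_integral_pushforward _ _ _ _ _ _ mX P setT _ measurableT mg'.
rewrite preimage_setT => <-; last by move=> x _; rewrite lee_fin expR_ge0.
rewrite le_eqVlt; apply/orP; left; apply/eqP.
by apply: eq_measure_integral => A mA _; exact: (run_law run).
Qed.

Let c := gam - lam ^+ 2 * sigma i ^+ 2 / 2.

Lemma reward_potential_step t z : (t < T)%N ->
  'E_P[reward_potential i k mu lam gam t]%E = z%:E ->
  ('E_P[reward_potential i k mu lam gam t.+1] <=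
   'E_P[fun w => (reward_potential i k mu lam gam t w *
     (1 - (1 - expR (- c)) * (choosers t.+1 i w k)%:R))%R])%E.
Proof.
move=> tT Ez; set V := reward_potential i k mu lam gam.
have V0 t' w : 0 <= V t' w by exact: expR_ge0.
pose y x : R := expR (lam * (x - mu) - gam).
pose f (D : {ffun 'I_K -> bool}) (L : {ffun 'I_K * 'I_K -> bool}) j x :=
  if D j && L (k, j) then y x else 1.
have my : measurable_fun setT y.
  apply: measurableT_comp => //; apply: measurable_funB => //.
  by apply: measurable_funM => //; exact: measurable_funB.
have VS w : V t.+1 w = V t w * 1 *
    \prod_j f (choosers t.+1 i w) (links t.+1 w) j (X t.+1 j i w).
  rewrite mulr1 /V /reward_potential deviationS obs_countS natrD.
  rewrite mulrDr [gam * _]mulrDr opprD addrACA expRD; congr (_ * _).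
  rewrite natr_sum !mulr_sumr -sumrB expR_sum; apply: eq_bigr => j _.
  rewrite /f; case: (choosers _ _ _ _); case: (links _ _ _) => /=;
    rewrite ?mul0r ?mulr0 ?subr0 ?expR0//.
  by rewrite mul1r mulr1.
have y0 x : 0 <= y x by exact: expR_ge0.
have Ey j : 'E_P[fun w => y (X t.+1 j i w)]%E =
    (fine 'E_P[fun w => y (X t.+1 j i w)])%:E.
  rewrite fineK// ge0_fin_numE ?expectation_ge0//.
  by apply: le_lt_trans (reward_mgf _ _) (ltry _).
have Eyc j : fine 'E_P[fun w => y (X t.+1 j i w)]%E <= expR (- c).
  by rewrite -lee_fin -Ey /c opprB; exact: reward_mgf.
have c0 : expR (- c) <= 1 by rewrite expR_le1 oppr_le0 subr_ge0.
rewrite (eq_expectation P VS).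
apply: (@step_le t i (V t) z tT (@past_reward_potential i k mu lam gam t) (V0 t) Ez
  (fun _ _ => 1) f
  (fun D L j => if D j && L (k, j) then
     fine 'E_P[fun w => y (X t.+1 j i w)]%E else 1)
  (fun D : {ffun 'I_K -> bool} => 1 - (1 - expR (- c)) * (D k)%:R)).
- by [].
- by move=> D L j; rewrite /f; case: (D j && L (k, j)).
- by move=> D L j x; rewrite /f; case: (D j && L (k, j)).
- by move=> D L j; rewrite /f; case: (D j && L (k, j)) => //; exact: expectation_cst.
- move=> D; case: (D k); rewrite ?mulr1 ?mulr0 ?subr0 ?subKr ?expR_ge0//.
move=> D; rewrite -[leRHS]mul1r -[X in _ <= X * _](link_prob_sum1 tT) mulr_suml.
apply: ler_sum => L _; rewrite mul1r.
have prod_le (s : pred 'I_K) : \prod_(j | s j) (if D j && L (k, j) then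
     fine 'E_P[fun w => y (X t.+1 j i w)]%E else 1) <= 1.
  apply: prodr_ile1 => j _; case: ifP => // _; last by rewrite ler01 lexx.
  by rewrite fine_ge0 ?expectation_ge0//= (le_trans (Eyc j)).
have [Lk|Lk] := boolP (L (k, k)); last by rewrite (link_prob_self tT Lk) !mul0r.
rewrite ler_wpM2l ?link_prob_ge0//.
case Dk: (D k); last by rewrite mulr0 subr0.
rewrite mulr1 subKr (bigD1 k)//= Dk Lk /=.
apply: le_trans (Eyc k); apply: ler_piMr => //.
by rewrite fine_ge0 ?expectation_ge0.
Qed.

Let c01 : 0 <= 1 - expR (- c) <= 1.
Proof. by rewrite subr_ge0 gerBl expR_ge0 expR_le1 oppr_le0 subr_ge0 gamP. Qed.

Let mV t : (t < T)%N -> measurable_fun [set: Omega] (reward_potential i k mu lam gam t).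
Proof. by move=> tT; apply: past_measurable_fun tT _; exact: past_reward_potential. Qed.

Let EV0 : ('E_P[reward_potential i k mu lam gam 0] <= 1)%E.
Proof.
rewrite (_ : reward_potential _ _ _ _ _ _ = cst 1) ?expectation_cst//.
apply/funext => w; rewrite /reward_potential /deviation /obs_count /obs_sum.
by rewrite !big_nil !mulr0n !(mulr0, subr0) expR0.
Qed.

Lemma reward_potential_le1 n : (n < T)%N ->
  ('E_P[reward_potential i k mu lam gam n] <= 1)%E.
Proof.
move=> nT; have V0 t w : 0 <= reward_potential i k mu lam gam t w by exact: expR_ge0.
have := @potential_sum _ _ _ P _ (fun t w => choosers t.+1 i w k) _ n c01
  (fun t tn => mV (leq_ltn_trans tn nT)) V0
  (fun t tn => @past_choosersP t i k (ltn_trans tn nT)) EV0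
  (fun t z tn => @reward_potential_step t z (ltn_trans tn nT)).
apply: le_trans; rewrite leeDl// mule_ge0 ?lee_fin//; first by have /andP[] := c01.
rewrite sume_ge0// => t _; apply: expectation_ge0 => w.
by rewrite mulr_ge0.
Qed.

Lemma reward_potential_sum :
  ((1 - expR (- c))%:E *
   \sum_(0 <= t < T) 'E_P[fun w => (reward_potential i k mu lam gam t w *
     (choosers t.+1 i w k)%:R)%R] <= 1)%E.
Proof.
apply: (@potential_sum_last _ _ _ P _ (fun t w => choosers t.+1 i w k)) => //.
- by move=> t w; exact: expR_ge0.
- by move=> t; exact: past_choosersP.
- by move=> t z tn; apply: reward_potential_step; exact: ltnW.
Qed.

End Reward.

Lemma obs_count_le i k t w : (obs_count I phi i k t w <= K * t)%N.
Proof.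
elim: t => [|t IH]; first by rewrite /obs_count big_nil.
rewrite obs_countS mulnS addnC leq_add//.
rewrite -[leqRHS]card_ord -sum1_card leq_sum// => j _.
by case: (choosers _ _ _ _); case: (links _ _ _).
Qed.

(* The rate making the Chernoff bound tight when n observations were made. *)
Definition chernoff_rate (i : 'I_N) (a : R) (t n : nat) : R :=
  Num.sqrt (2 * a * ln t%:R / n%:R) / sigma i.

Definition underestimate_bound i k mu a t w : R :=
  \sum_(n < K * t) expR (- (a * ln t%:R)) *
    reward_potential i k mu (- chernoff_rate i a t n.+1)
      (chernoff_rate i a t n.+1 ^+ 2 * sigma i ^+ 2 / 2) t w.

Lemma underestimate_boundP i k mu a t w : 0 < sigma i -> 0 <= a ->
  (0 < obs_count I phi i k t w)%N ->
  obs_mean X I phi i k t w + sigma i *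
    Num.sqrt (2 * a * ln t%:R / (obs_count I phi i k t w)%:R) <= mu ->
  1 <= underestimate_bound i k mu a t w.
Proof.
move=> s0 a0 n0 hmu.
set n := obs_count I phi i k t w in n0 hmu *.
have nK : (n.-1 < K * t)%N by rewrite prednK//; exact: obs_count_le.
have n0' : 0 < n%:R :> R by rewrite ltr0n.
have l0 : 0 <= ln t%:R :> R.
  by case: t @n {hmu n0 n0'} nK => [|t] n nK; [rewrite muln0 in nK|rewrite ln_ge0// ler1n].
rewrite /underestimate_bound (bigD1 (Ordinal nK))//= prednK//.
rewrite -[leLHS]addr0; apply: lerD; last first.
  by apply: sumr_ge0 => j _; rewrite mulr_ge0// expR_ge0.
rewrite /reward_potential -expRD -[leLHS]expR0 ler_expR -/n.
have sq : Num.sqrt (2 * a * ln t%:R / n%:R) ^+ 2 = 2 * a * ln t%:R / n%:R.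
  by rewrite sqr_sqrtr// divr_ge0 ?ler0n// !mulr_ge0.
have s_ge0 : 0 <= Num.sqrt (2 * a * ln t%:R / n%:R) by exact: sqrtr_ge0.
rewrite /chernoff_rate; set s := Num.sqrt _ in hmu sq s_ge0 *.
have dev : deviation i k mu t w <= - (n%:R * (sigma i * s)).
  rewrite /deviation -/n.
  have -> : obs_sum X I phi i k t w = obs_mean X I phi i k t w * n%:R.
    by rewrite /obs_mean -/n divfK// gt_eqF.
  by have := ler_wpM2r (ltW n0') hmu; rewrite mulrDl => h; lra.
have r0 : 0 <= s / sigma i by rewrite divr_ge0// ltW.
have rs : s / sigma i * sigma i = s by rewrite divfK// gt_eqF.
set r := s / sigma i in r0 rs *.
have sn : s ^+ 2 * n%:R = 2 * (a * ln t%:R).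
  by rewrite sq divfK ?gt_eqF// mulrA.
have := ler_wpM2l r0 dev.
have -> : r * - (n%:R * (sigma i * s)) = - (s ^+ 2 * n%:R).
  by transitivity (- (r * sigma i * s * n%:R)); [ring|rewrite rs; ring].
rewrite -exprMn rs; lra.
Qed.

Lemma measurable_reward_potential i k mu lam gam t : (t < T)%N ->
  measurable_fun [set: Omega] (reward_potential i k mu lam gam t).
Proof. by move=> tT; apply: past_measurable_fun tT _; exact: past_reward_potential. Qed.

Lemma underestimate_bound_ge0 i k mu a t w : 0 <= underestimate_bound i k mu a t w.
Proof. by apply: sumr_ge0 => n _; rewrite mulr_ge0// expR_ge0. Qed.

Lemma measurable_underestimate_bound i k mu a t : (t < T)%N ->
  measurable_fun [set: Omega] (underestimate_bound i k mu a t).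
Proof.
move=> tT; apply: measurable_sum => n; apply: measurable_funM => //.
exact: measurable_reward_potential.
Qed.

Lemma expectation_underestimate_bound i k mu a t :
  sub_gaussian (nu i) mu (sigma i) -> (t < T)%N ->
  ('E_P[underestimate_bound i k mu a t] <=
   ((K * t)%:R * expR (- (a * ln t%:R)))%:E)%E.
Proof.
move=> sg tT; rewrite ge0_expectation_sum; last 2 first.
- move=> n; apply: measurable_funM => //; exact: measurable_reward_potential.
- by move=> n w; rewrite mulr_ge0// expR_ge0.
have -> : (K * t)%:R * expR (- (a * ln t%:R)) =
    \sum_(n < K * t) expR (- (a * ln t%:R)).
  by rewrite sumr_const card_ord mulr_natl.
rewrite -sumEFin.
apply: lee_sum => n _; rewrite ge0_expectationZl ?expR_ge0//; last 2 first.
- exact: measurable_reward_potential.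
- by move=> w; exact: expR_ge0.
rewrite -[leRHS]mule1 lee_wpmul2l ?lee_fin ?expR_ge0//.
by apply: reward_potential_le1 => //; rewrite sqrrN.
Qed.

Lemma overestimateP i k mu dlt t w : 0 < sigma i -> 0 <= dlt ->
  dlt * (obs_count I phi i k t w)%:R <= deviation i k mu t w ->
  1 <= reward_potential i k mu (dlt / sigma i ^+ 2)
    (3 * dlt ^+ 2 / (4 * sigma i ^+ 2)) t w.
Proof.
move=> s0 d0 h; rewrite -[leLHS]expR0 ler_expR.
have s2 : 0 < sigma i ^+ 2 by rewrite exprn_gt0.
have r0 : 0 <= dlt / sigma i ^+ 2 by rewrite divr_ge0// ltW.
have := ler_wpM2l r0 h.
have -> : 3 * dlt ^+ 2 / (4 * sigma i ^+ 2) = (dlt / sigma i ^+ 2 * dlt) * (3 / 4).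
  by field; rewrite gt_eqF.
set x := dlt / _ * dlt; rewrite mulrA -/x.
have x0 : 0 <= x by rewrite mulr_ge0.
have : 0 <= x * (obs_count I phi i k t w)%:R by rewrite mulr_ge0.
by lra.
Qed.

Lemma own_countE i k w :
  own_count phi i k T w = (\sum_(0 <= t < T) choosers t.+1 i w k)%N.
Proof.
rewrite /own_count big_add1; apply: eq_bigr => t _; by rewrite ffunE.
Qed.

Lemma measurable_own_count i k :
  measurable_fun [set: Omega] (fun w => (own_count phi i k T w)%:R : R).
Proof.
rewrite (_ : (fun w => _) =
    (fun w => \sum_(0 <= t < T) (choosers t.+1 i w k)%:R)).
  by apply: measurable_sum_nat => t tT; exact: past_choosersP.
by apply/funext => w; rewrite own_countE natr_sum.
Qed.

Lemma own_count_le i k w : (own_count phi i k T w <= T)%N.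
Proof.
rewrite own_countE big_mkord -[leqRHS]card_ord -sum1_card leq_sum// => t _.
exact: leq_b1.
Qed.

Section Arm.
Variables (mu : 'I_N -> R) (istar i : 'I_N).
Hypotheses (sg : forall i, sub_gaussian (nu i) (mu i) (sigma i))
  (sigma_gt0 : forall i, 0 < sigma i) (xi1 : 1 < xi)
  (coef_ge0 : forall k, 0 <= explore_coef m e p k).

Let Delta := mu istar - mu i.
Hypothesis Delta_gt0 : 0 < Delta.

Definition index_coef k : R := (1 + explore_coef m e p k) * (xi + 1).

Lemma index_coef_ge k : xi + 1 <= index_coef k.
Proof. by rewrite ler_peMl// ?lerDl// addr_ge0// ltW// (lt_trans ltr01). Qed.

Let a0 k : 0 <= index_coef k.
Proof. by apply: le_trans (index_coef_ge k); rewrite addr_ge0// ltW// (lt_trans ltr01). Qed.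

Definition sample_bound k : R :=
  2 * sigma i ^+ 2 * index_coef k * ln T%:R / (9 / 10 * Delta) ^+ 2.

Definition rarely_sampled k t w : bool :=
  choosers t.+1 i w k && ((obs_count I phi i k t w)%:R <= sample_bound k).

Let over k t w : R := reward_potential i k (mu i) (Delta / 10 / sigma i ^+ 2)
  (3 * (Delta / 10) ^+ 2 / (4 * sigma i ^+ 2)) t w.

Lemma pull_cases k t w : (t < T)%N ->
  (choosers t.+1 i w k)%:R <= (rarely_sampled k t w)%:R +
    over k t w * (choosers t.+1 i w k)%:R +
    underestimate_bound istar k (mu istar) (index_coef k) t w.
Proof.
move=> tT; rewrite /rarely_sampled.
have U0 := underestimate_bound_ge0 istar k (mu istar) (index_coef k) t w.
case ch: (choosers _ _ _ _) => /=; last by rewrite mulr0 !add0r.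
rewrite mulr1; have O0 : 0 <= over k t w by exact: expR_ge0.
have [_|Nl] := leP (obs_count I phi i k t w)%:R (sample_bound k).
  by rewrite -addrA lerDl addr_ge0.
rewrite add0r.
have T1 : 1 <= T%:R :> R by rewrite ler1n (leq_ltn_trans _ tT).
have D0 : 0 < 9 / 10 * Delta by rewrite mulr_gt0// divr_gt0.
have l0 : 0 <= sample_bound k.
  by rewrite divr_ge0 ?sqr_ge0// mulr_ge0 ?ln_ge0// mulr_ge0// mulr_ge0 ?sqr_ge0.
set n := obs_count I phi i k t w in Nl.
have n0 : 0 < n%:R :> R by exact: le_lt_trans Nl.
have [hover|hover] := leP (Delta / 10 * n%:R) (deviation i k (mu i) t w).
  rewrite -[leLHS]addr0 lerD//; apply: overestimateP => //.
  by rewrite divr_ge0// ltW.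
rewrite -[leLHS]add0r lerD//.
move: ch; rewrite ffunE => /eqP ch.
have := run_rule run k w istar tT; rewrite ch /ucb_index.
rewrite -/n; have n0' : n == 0%N = false.
  by apply/negbTE; rewrite -lt0n -(ltr0n R).
rewrite n0'; case: eqP => [_|/eqP nstar]; first by rewrite leye_eq.
rewrite lee_fin => hrule; apply: underestimate_boundP => //.
  by rewrite lt0n.
have -> : 2 * index_coef k = 2 * (1 + explore_coef m e p k) * (xi + 1).
  by rewrite mulrA.
apply: le_trans hrule _.
have hmean : obs_mean X I phi i k t w < mu i + Delta / 10.
  rewrite /obs_mean -/n ltr_pdivrMr//; move: hover; rewrite /deviation -/n.
  by lra.
have hconf : sigma i * Num.sqrt (2 * (1 + explore_coef m e p k) * (xi + 1) *
    ln t%:R / n%:R) <= 9 / 10 * Delta.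
  have -> : 2 * (1 + explore_coef m e p k) * (xi + 1) = 2 * index_coef k.
    by rewrite mulrA.
  have s0 := sigma_gt0 i; have s20 : 0 < sigma i ^+ 2 by rewrite exprn_gt0.
  rewrite mulrC -ler_pdivlMr//.
  have -> : 9 / 10 * Delta / sigma i = Num.sqrt ((9 / 10 * Delta / sigma i) ^+ 2).
    by rewrite sqrtr_sqr ger0_norm// divr_ge0// ltW.
  apply: ler_wsqrtr; rewrite ler_pdivrMr//.
  have lnT : ln t%:R <= ln T%:R :> R by rewrite ler_ln_nat// ltnW.
  have D20 : 0 < (9 / 10 * Delta) ^+ 2 by rewrite exprn_gt0.
  move: Nl; rewrite /sample_bound ltr_pdivrMr// => /ltW Nl.
  rewrite expr_div_n [leRHS]mulrAC ler_pdivlMr// [leRHS]mulrC; apply: le_trans Nl.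
  have -> : 2 * index_coef k * ln t%:R * sigma i ^+ 2 =
            2 * sigma i ^+ 2 * index_coef k * ln t%:R by ring.
  by rewrite ler_wpM2l// mulr_ge0// mulr_ge0// ltW.
rewrite /Delta in hmean hconf; lra.
Qed.

Let measurable_over k t : (t < T)%N -> measurable_fun [set: Omega]
  (fun w => over k t w * (choosers t.+1 i w k)%:R).
Proof.
move=> tT; apply: measurable_funM; first exact: measurable_reward_potential.
exact: past_choosersP.
Qed.

Lemma expectation_over k :
  (\sum_(0 <= t < T) 'E_P[fun w => (over k t w * (choosers t.+1 i w k)%:R)%R] <=
   (1 + 400 * (sigma i ^+ 2 / Delta ^+ 2))%:E)%E.
Proof.
have s20 : 0 < sigma i ^+ 2 by rewrite exprn_gt0.
have D20 : 0 < Delta ^+ 2 by rewrite exprn_gt0.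
set S := (\sum_(_ <= t < T) _)%E.
have gamP : (Delta / 10 / sigma i ^+ 2) ^+ 2 * sigma i ^+ 2 / 2 <=
    3 * (Delta / 10) ^+ 2 / (4 * sigma i ^+ 2).
  have -> : (Delta / 10 / sigma i ^+ 2) ^+ 2 * sigma i ^+ 2 / 2 =
      2 * (Delta / 10) ^+ 2 / (4 * sigma i ^+ 2) by field; rewrite gt_eqF.
  by rewrite ler_pM2r ?invr_gt0 ?mulr_gt0// ler_wpM2r ?sqr_ge0// ler_nat.
have := reward_potential_sum k (sg i) gamP; rewrite -/S.
have -> : 3 * (Delta / 10) ^+ 2 / (4 * sigma i ^+ 2) -
   (Delta / 10 / sigma i ^+ 2) ^+ 2 * sigma i ^+ 2 / 2 =
   (400 * (sigma i ^+ 2 / Delta ^+ 2))^-1.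
  by field; rewrite !gt_eqF.
set u := 400 * _.
have u0 : 0 < u by apply: mulr_gt0; [rewrite ltr0n|exact: divr_gt0].
have h : (1 + u)^-1 <= 1 - expR (- u^-1).
  have u1 : 0 < 1 + u^-1 by rewrite addr_gt0// invr_gt0.
  have : expR (- u^-1) <= (1 + u^-1)^-1.
    by rewrite expRN lef_pV2 ?posrE ?expR_gt0//; exact: expR_ge1Dx.
  have -> : (1 + u^-1)^-1 = 1 - (1 + u)^-1 by field; rewrite !gt_eqF// addr_gt0.
  lra.
have u1 : 0 < 1 + u by rewrite addr_gt0.
have S0 : (0 <= S)%E.
  apply: sume_ge0 => t _; apply: expectation_ge0 => w.
  by rewrite mulr_ge0// expR_ge0.
move=> hS; have : ((1 + u)^-1%:E * S <= 1)%E.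
  by apply: le_trans hS; rewrite lee_wpmul2r// lee_fin.
by rewrite lee_pdivrMl// mule1.
Qed.

Lemma expectation_under k :
  (\sum_(0 <= t < T) 'E_P[underestimate_bound istar k (mu istar) (index_coef k) t]
   <= (K%:R * (1 + (xi - 1)^-1))%:E)%E.
Proof.
apply: (@le_trans _ _ (\sum_(0 <= t < T)
    K%:R * (t%:R * expR (- ((xi + 1) * ln t%:R))))%:E).
  rewrite -sumEFin big_nat [leRHS]big_nat; apply: lee_sum => t /= tT.
  apply: le_trans (expectation_underestimate_bound _ _ _ _) _ => //.
  rewrite lee_fin natrM -mulrA ler_wpM2l// ler_wpM2l// ler_expR lerN2.
  by rewrite ler_wpM2r ?ln_nat_ge0 ?index_coef_ge.
by rewrite -mulr_sumr lee_fin ler_wpM2l// sum_npow_le.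
Qed.

Lemma arm_expectation (G : Omega -> R) (g : R) :
  measurable_fun setT G ->
  (forall w, \sum_(k < K) \sum_(0 <= t < T) (rarely_sampled k t w)%:R <= G w) ->
  ('E_P[G] <= g%:E)%E ->
  (\sum_(k < K) 'E_P[fun w => (own_count phi i k T w)%:R] <=
   (g + K%:R * (1 + 400 * (sigma i ^+ 2 / Delta ^+ 2)) +
    K%:R ^+ 2 * (1 + (xi - 1)^-1))%:E)%E.
Proof.
move=> mG hG Gg.
have G0 w : 0 <= G w.
  by apply: le_trans (hG w); apply: sumr_ge0 => k _; apply: sumr_ge0.
pose U k w := \sum_(0 <= t < T) underestimate_bound istar k (mu istar) (index_coef k) t w.
pose O k w := \sum_(0 <= t < T) over k t w * (choosers t.+1 i w k)%:R.
have own k w : (own_count phi i k T w)%:R =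
    \sum_(0 <= t < T) (choosers t.+1 i w k)%:R :> R.
  by rewrite own_countE natr_sum.
have mO k : measurable_fun [set: Omega] (O k).
  by apply: measurable_sum_nat => t tT; exact: measurable_over.
have mU k : measurable_fun [set: Omega] (U k).
  by apply: measurable_sum_nat => t tT; exact: measurable_underestimate_bound.
have O0 k w : 0 <= O k w.
  by apply: sumr_ge0 => t _; rewrite mulr_ge0// expR_ge0.
have U0 k w : 0 <= U k w.
  by apply: sumr_ge0 => t _; exact: underestimate_bound_ge0.
rewrite -ge0_expectation_sum//; last by move=> k; exact: measurable_own_count.
apply: (@le_trans _ _ ('E_P[fun w => (G w + \sum_(k < K) O k w + \sum_(k < K) U k w)%R])%E).
  apply: ge0_le_expectation => //.
  - by apply: measurable_sum => k; exact: measurable_own_count.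
  - by apply: measurable_funD; [apply: measurable_funD => //|]; exact: measurable_sum.
  - by move=> w; exact: sumr_ge0.
  - move=> w; apply: (@le_trans _ _ (\sum_(k < K) \sum_(0 <= t < T)
      (rarely_sampled k t w)%:R + \sum_(k < K) O k w + \sum_(k < K) U k w)).
      2: by rewrite !lerD2r.
    rewrite -!big_split/=; apply: ler_sum => k _; rewrite own /O /U -!big_split/=.
    rewrite big_nat [leRHS]big_nat; apply: ler_sum => t /= tT; exact: pull_cases.
rewrite ge0_expectationD//; last 4 first.
- by apply: measurable_funD => //; exact: measurable_sum.
- exact: measurable_sum.
- by move=> w; rewrite addr_ge0// sumr_ge0.
- by move=> w; exact: sumr_ge0.
rewrite ge0_expectationD//; last 2 first.
- exact: measurable_sum.
- by move=> w; exact: sumr_ge0.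
rewrite !ge0_expectation_sum// !EFinD; apply: leeD; first apply: leeD => //.
  apply: (@le_trans _ _ (\sum_(k < K) (1 + 400 * (sigma i ^+ 2 / Delta ^+ 2)))%:E).
    rewrite -sumEFin; apply: lee_sum => k _.
    rewrite ge0_expectation_sum_nat//; first exact: expectation_over.
      by move=> t tT; exact: measurable_over.
    by move=> t w; rewrite mulr_ge0// expR_ge0.
  by rewrite sumr_const card_ord lee_fin -[leLHS]mulr_natl.
apply: (@le_trans _ _ (\sum_(k < K) (K%:R * (1 + (xi - 1)^-1)))%:E).
  rewrite -sumEFin; apply: lee_sum => k _.
  rewrite ge0_expectation_sum_nat//; first exact: expectation_under.
    by move=> t tT; exact: measurable_underestimate_bound.
  by move=> t w; exact: underestimate_bound_ge0.
by rewrite sumr_const card_ord lee_fin -[leLHS]mulr_natl mulrA -expr2.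
Qed.

End Arm.

End RunTheory.

Lemma count_below (R : realType) (C b : nat -> nat) (c : nat) (l : R) (n : nat) :
  0 <= l -> (forall t, (b t <= c)%N) ->
  (forall t, (t < n)%N -> (C t + b t <= C t.+1)%N) ->
  \sum_(0 <= t < n) (b t)%:R * ((C t)%:R <= l)%R%:R <= l + c%:R.
Proof.
move=> l0 bc; suff H : (forall t, (t < n)%N -> (C t + b t <= C t.+1)%N) ->
    \sum_(0 <= t < n) (b t)%:R * ((C t)%:R <= l)%R%:R <= (C n)%:R :> R /\
    \sum_(0 <= t < n) (b t)%:R * ((C t)%:R <= l)%R%:R <= l + c%:R.
  by move=> CS; have [] := H CS.
elim: n => [|n IH] CS; first by rewrite big_nil addr_ge0.
have [h1 h2] := IH (fun t tn => CS t (leqW tn)).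
rewrite big_nat_recr//=; set S := \sum_(_ <= _ < _) _ in h1 h2 *.
have C1 : (C n)%:R + (b n)%:R <= (C n.+1)%:R :> R by rewrite -natrD ler_nat CS.
have b0 : 0 <= (b n)%:R :> R by [].
have bcn : (b n)%:R <= c%:R :> R by rewrite ler_nat.
by have [Cl|_] := leP (C n)%:R l; rewrite ?mulr1 ?mulr0; split; lra.
Qed.

Section Counting.
Context (R : realType) (K m N T : nat) (e : rel 'I_K) (p xi : R)
  (nu : 'I_N -> probability (measurableTypeR R) R) (sigma : 'I_N -> R)
  (d : measure_display) (Omega : measurableType d) (P : probability Omega R)
  (X : nat -> 'I_K -> 'I_N -> {RV P >-> R})
  (I : nat -> 'I_K -> 'I_K -> Omega -> bool)
  (phi : nat -> 'I_K -> Omega -> 'I_N).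
Hypothesis run : bandit_run m T e p xi nu sigma X I phi.

Lemma sum_rarely_sampled (mu : 'I_N -> R) (istar i : 'I_N) k w :
  0 <= sample_bound m T e p xi sigma mu istar i k ->
  \sum_(0 <= t < T)
     (rarely_sampled m T e p xi sigma I phi mu istar i k t w)%:R <=
  sample_bound m T e p xi sigma mu istar i k + 1.
Proof.
move=> l0.
have := @count_below R (fun t => obs_count I phi i k t w)
  (fun t => choosers phi t.+1 i w k) 1 _ T l0 _ _.
under eq_bigr do rewrite -natrM mulnb.
apply; first by move=> t; exact: leq_b1.
move=> t tT; rewrite obs_countS leq_add2l (bigD1 k)//= [links _ _ _ _]ffunE /=.
by rewrite (run_link_self run)// muln1 leq_addr.
Qed.

Definition total_count (i : 'I_N) (t : nat) (w : Omega) : nat :=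
  \sum_(1 <= s < t.+1) \sum_(j < K) choosers phi s i w j.

Lemma total_countS i t w : total_count i t.+1 w =
  (total_count i t w + \sum_(j < K) choosers phi t.+1 i w j)%N.
Proof. by rewrite /total_count big_nat_recr. Qed.

Lemma sum_total_count i w (l : R) : 0 <= l ->
  \sum_(0 <= t < T) (\sum_(j < K) choosers phi t.+1 i w j)%:R *
     ((total_count i t w)%:R <= l)%R%:R <= l + K%:R.
Proof.
move=> l0; apply: count_below => // t; last by rewrite total_countS.
by rewrite -[leqRHS]card_ord -sum1_card leq_sum// => j _; exact: leq_b1.
Qed.

Lemma past_total_count i t :
  past_measurable X I phi t (fun w => (total_count i t w)%:R : R).
Proof.
rewrite (_ : (fun w => _) = (fun w => \sum_(1 <= s < t.+1) \sum_(j < K)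
    (phi s j w == i)%:R)).
  apply: past_sum_nat => s /andP[s0 st]; apply: measurable_sum => j.
  by apply: past_choice; rewrite s0 leqW.
apply/funext => w; rewrite /total_count natr_sum; apply: eq_bigr => s _.
by rewrite natr_sum; apply: eq_bigr => j _; rewrite ffunE.
Qed.

Section Complete.
Hypotheses (complete : forall k j, k != j -> e k j) (p01 : 0 < p <= 1).
Hypothesis K0 : (0 < K)%N.

Definition link_rate : R := (8 * K%:R)^-1.

Definition link_decay : R := expR (- (p * link_rate / 8)).

(* Growth over one step of the potential exp(lambda (3 p / 4 * S - N)), where S
   counts the pulls of an arm by all agents and N the observations of one agent. *)
Definition link_factor k (D : {ffun 'I_K -> bool})
    (L : {ffun 'I_K * 'I_K -> bool}) : R :=
  expR (link_rate * (3 / 4 * p * (\sum_(j < K) D j)%:R -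
                     (\sum_(j < K) D j * L (k, j))%:R)).

Definition chosen (D : {ffun 'I_K -> bool}) : bool := [exists j, D j].

Lemma link_rate_gt0 : 0 < link_rate.
Proof. by rewrite invr_gt0 mulr_gt0// ltr0n. Qed.

Lemma link_decay_lt1 : link_decay < 1.
Proof.
rewrite -[ltRHS]expR0 ltr_expR oppr_lt0 divr_gt0// mulr_gt0// ?link_rate_gt0//.
by have /andP[] := p01.
Qed.

Lemma link_mean_ge t k (D : {ffun 'I_K -> bool}) : (t < T)%N ->
  p * (\sum_(j < K) D j)%:R <=
  \sum_L link_prob P I t.+1 L * (\sum_(j < K) D j * L (k, j))%:R.
Proof.
move=> tT; rewrite natr_sum mulr_sumr.
under [leRHS]eq_bigr do rewrite natr_sum mulr_sumr.
rewrite exchange_big/=; apply: ler_sum => j _.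
under eq_bigr do rewrite natrM mulrCA.
rewrite -mulr_sumr mulrC ler_wpM2l//.
have [<-|kj] := eqVneq k j; last by rewrite (link_prob_mean run)// complete.
have /andP[_ p1] := p01; apply: le_trans p1 _.
rewrite -[leLHS](link_prob_sum1 run tT); apply: ler_sum => L _.
have [Lk|Lk] := boolP (L (k, k)); first by rewrite /= mulr1.
by rewrite (link_prob_self run tT Lk) mul0r.
Qed.

Lemma link_factor_mean t k D : (t < T)%N ->
  \sum_L link_prob P I t.+1 L * link_factor k D L <=
  1 - (1 - link_decay) * (chosen D)%:R.
Proof.
move=> tT; have lam0 := link_rate_gt0.
have := link_mean_ge k D tT.
rewrite /link_factor; set s := (\sum_(j < K) D j)%N.
pose A (L : {ffun 'I_K * 'I_K -> bool}) := (\sum_(j < K) D j * L (k, j))%N.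
under eq_bigr do rewrite -/(A _); under [in X in _ -> X]eq_bigr do rewrite -/(A _).
have As L : (A L <= s)%N.
  rewrite /A /s.
  apply: leq_sum => j _; by rewrite -[leqRHS]muln1 leq_mul2l leq_b1 orbT.
have sK : (s <= K)%N.
  by rewrite -[leqRHS]card_ord -sum1_card leq_sum// => j _; exact: leq_b1.
have ls : link_rate * s%:R <= 8^-1.
  rewrite /link_rate invfM -mulrA ler_piMr// ?invr_ge0// mulrC.
  by rewrite ler_pdivrMr ?ltr0n// mul1r ler_nat.
move=> hmean.
have hexp L : expR (- (link_rate * (A L)%:R)) <= 1 - 7 / 8 * (link_rate * (A L)%:R).
  set x := link_rate * _.
  have x0 : 0 <= x by rewrite mulr_ge0// ltW.
  have x8 : x <= 8^-1 by apply: le_trans ls; rewrite ler_wpM2l ?ler_nat// ltW.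
  rewrite expRN -[leRHS]invrK lef_pV2 ?posrE ?expR_gt0//.
  - apply: le_trans (expR_ge1Dx x).
    have h : 0 < 1 - 7 / 8 * x by lra.
    rewrite -[leLHS]mul1r ler_pdivrMr//; nra.
  - by rewrite invr_gt0; lra.
have hsum : \sum_L link_prob P I t.+1 L * expR (- (link_rate * (A L)%:R)) <=
    expR (- (7 / 8 * link_rate * (p * s%:R))).
  apply: le_trans (expR_ge1Dx _).
  apply: (@le_trans _ _ (1 - 7 / 8 * link_rate *
    \sum_L link_prob P I t.+1 L * (A L)%:R)); last first.
    by rewrite lerD2l lerN2 ler_wpM2l// mulr_ge0// ltW.
  rewrite -[X in X - _](link_prob_sum1 run tT) mulr_sumr -sumrB.
  apply: ler_sum => L _.
  have -> : link_prob P I t.+1 L - 7 / 8 * link_rate * (link_prob P I t.+1 L * (A L)%:R) =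
    link_prob P I t.+1 L * (1 - 7 / 8 * (link_rate * (A L)%:R)) by ring.
  by rewrite ler_wpM2l// link_prob_ge0.
have -> : \sum_L link_prob P I t.+1 L *
    expR (link_rate * (3 / 4 * p * s%:R - (A L)%:R)) =
  expR (link_rate * (3 / 4 * p * s%:R)) *
    \sum_L link_prob P I t.+1 L * expR (- (link_rate * (A L)%:R)).
  rewrite mulr_sumr; apply: eq_bigr => L _.
  by rewrite mulrBr expRD mulrCA.
have := ler_wpM2l (expR_ge0 (link_rate * (3 / 4 * p * s%:R))) hsum.
move=> /le_trans; apply; rewrite -expRD.
have p0 : 0 < p by have /andP[] := p01.
rewrite /chosen; case: existsP => [[j Dj]|_] /=; last first.
  rewrite mulr0 subr0 -[leRHS]expR0 ler_expR.
  have : 0 <= link_rate * p * s%:R by rewrite mulr_ge0// mulr_ge0// ltW.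
  by lra.
rewrite mulr1 subKr ler_expR.
have s1 : 1 <= s%:R :> R by rewrite ler1n /s (bigD1 j)//= Dj.
have : link_rate * p * 1 <= link_rate * p * s%:R.
  by rewrite ler_wpM2l// mulr_ge0// ltW.
lra.
Qed.

Definition link_potential i k t w : R :=
  expR (link_rate * (3 / 4 * p * (total_count i t w)%:R -
                     (obs_count I phi i k t w)%:R)).

Lemma past_link_potential i k t :
  past_measurable X I phi t (link_potential i k t).
Proof.
apply: measurableT_comp => //; apply: measurable_funM => //.
apply: measurable_funB; last exact: past_obs_count.
by apply: measurable_funM => //; exact: past_total_count.
Qed.

Lemma link_potential_step i k t z : (t < T)%N ->
  'E_P[link_potential i k t]%E = z%:E ->
  ('E_P[link_potential i k t.+1] <=
   'E_P[fun w => (link_potential i k t w *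
     (1 - (1 - link_decay) * (chosen (choosers phi t.+1 i w))%:R))%R])%E.
Proof.
move=> tT Ez; set V := link_potential i k.
have V0 t' w : 0 <= V t' w by exact: expR_ge0.
have VS w : V t.+1 w = V t w *
    link_factor k (choosers phi t.+1 i w) (links I t.+1 w) * \prod_(j < K) 1.
  rewrite big1_eq mulr1 /V /link_potential /link_factor -expRD -mulrDr.
  by rewrite total_countS obs_countS !natrD; congr (expR (_ * _)); ring.
rewrite (eq_expectation P VS).
apply: (@step_le _ _ _ _ _ _ _ _ _ _ _ _ P _ _ _ run t i (V t) z tT
  (@past_link_potential i k t) (V0 t) Ez
  (link_factor k) (fun _ _ _ _ => 1) (fun _ _ _ => 1)
  (fun D => 1 - (1 - link_decay) * (chosen D)%:R)) => //.
- by move=> D L; exact: expR_ge0.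
- by move=> D L j; exact: expectation_cst.
- move=> D; case: (chosen D); rewrite ?mulr1 ?mulr0 ?subr0 ?subKr ?expR_ge0//.
move=> D; apply: le_trans (link_factor_mean k D tT).
by apply: ler_sum => L _; rewrite big1_eq mulr1.
Qed.

Lemma measurable_chosen t i : (t < T)%N ->
  measurable_fun [set: Omega] (fun w => (chosen (choosers phi t.+1 i w))%:R : R).
Proof.
move=> tT; rewrite (_ : (fun w => _) =
    (fun w => 1 - \prod_(j < K) (1 - (choosers phi t.+1 i w j)%:R))).
  apply: measurable_funB => //; apply: measurable_prod => j _.
  by apply: measurable_funB => //; exact: (past_choosersP run).
apply/funext => w; rewrite /chosen; case: existsP => [[j Dj]|noD].
  by rewrite (bigD1 j)//= Dj subrr mul0r subr0.
rewrite big1 ?subrr// => j _; case Dj: (choosers _ _ _ _ _).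
  by case: noD; exists j.
by rewrite subr0.
Qed.

Lemma link_potential_sum i k :
  ((1 - link_decay)%:E *
   \sum_(0 <= t < T) 'E_P[fun w => (link_potential i k t w *
     (chosen (choosers phi t.+1 i w))%:R)%R] <= 1)%E.
Proof.
apply: (@potential_sum_last _ _ _ P _ (fun t w => chosen (choosers phi t.+1 i w))) => //.
- by rewrite subr_ge0 gerBl expR_ge0 ltW// link_decay_lt1.
- by move=> t tT; apply: (past_measurable_fun run tT); exact: past_link_potential.
- by move=> t w; exact: expR_ge0.
- by move=> t; exact: measurable_chosen.
- rewrite (_ : link_potential _ _ _ = cst 1) ?expectation_cst//.
  apply/funext => w; rewrite /link_potential /total_count /obs_count !big_nil.
  by rewrite !mulr0n mulr0 subrr mulr0 expR0.
- by move=> t z tT; apply: link_potential_step; exact: ltnW.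
Qed.

End Complete.

End Counting.

Section Graph.
Context (R : realType) (K m : nat) (e : rel 'I_K) (p : R).
Hypotheses (hG : symmetric_multi_star m e) (p01 : 0 <= p <= 1).

Lemma card_centers : #|[set j : 'I_K | (j < m)%N]%SET| = m.
Proof.
by rewrite -sum1dep_card (big_ord_narrow (ms_center_le hG)) sum1_card card_ord.
Qed.

Lemma peripheral_degree (k : 'I_K) : (m <= k)%N -> degree e k = 1%N.
Proof.
move=> mk; have [c _ ec] := ms_peripheral hG mk.
rewrite /degree (_ : [set j | e k j]%SET = [set c]%SET) ?cards1//.
by apply/setP => j; rewrite !inE ec.
Qed.

Lemma nbr_avg_degree_le (k : 'I_K) : (k < m)%N ->
  nbr_avg_degree R e k <= (degree e k)%:R.
Proof.
move=> km; rewrite /nbr_avg_degree.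
have [->|d0] := eqVneq (degree e k) 0%N; first by rewrite invr0 mulr0.
have d0' : 0 < (degree e k)%:R :> R by rewrite ltr0n lt0n.
rewrite ler_pdivrMr//.
apply: (@le_trans _ _ (\sum_(j < K | e k j) (degree e k)%:R)).
  apply: ler_sum => j _; rewrite ler_nat; have [jm|mj] := ltnP j m.
    by rewrite (ms_balanced hG jm km).
  by rewrite peripheral_degree// lt0n.
by rewrite sumr_const -[leLHS]mulr_natl /degree cardsE.
Qed.

Lemma nbr_avg_degree_ge0 (k : 'I_K) : 0 <= nbr_avg_degree R e k.
Proof. by rewrite divr_ge0// sumr_ge0. Qed.

Lemma explore_coef_ge0 k : 0 <= explore_coef m e p k.
Proof.
rewrite /explore_coef; case: ifP => // km.
by rewrite divr_ge0// mulr_ge0 ?powR_ge0// subr_ge0 nbr_avg_degree_le.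
Qed.

Lemma explore_coef_le1 k : explore_coef m e p k <= 1.
Proof.
rewrite /explore_coef; case: ifP => // km.
have [->|d0] := eqVneq (degree e k) 0%N; first by rewrite invr0 mulr0.
have d0' : 0 < (degree e k)%:R :> R by rewrite ltr0n lt0n.
rewrite ler_pdivrMr// mul1r; apply: (@le_trans _ _ ((degree e k)%:R - nbr_avg_degree R e k)).
  rewrite ler_piMl ?subr_ge0 ?nbr_avg_degree_le//.
  have /andP[p0 p1] := p01.
  have one : 1 `^ (1 - p) = 1 :> R by rewrite powR1.
  by rewrite -[leRHS]one ge0_ler_powR ?subr_ge0// nnegrE.
by rewrite lerBlDr lerDl nbr_avg_degree_ge0.
Qed.

Lemma complete_of_no_peripheral : K = m -> forall k j : 'I_K, k != j -> e k j.
Proof.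
move=> Km k j; apply: (ms_centers hG); rewrite -Km; exact: ltn_ord.
Qed.

Lemma peripheral_count : (m < K)%N -> (m <= K - m)%N.
Proof.
move=> mK.
set C := [set j : 'I_K | (j < m)%N]%SET.
have [c cm ec] := ms_peripheral hG (leqnn m : (m <= Ordinal mK)%N).
have degC (k : 'I_K) : (k < m)%N -> (m <= degree e k)%N.
  move=> km; rewrite (ms_balanced hG km cm).
  rewrite -card_centers -/C (cardsD1 c C) inE cm.
  rewrite /degree (cardsD1 (Ordinal mK) [set j | e c j]%SET) inE.
  rewrite (ms_sym hG) ec eqxx leq_add2l; apply: subset_leq_card.
  apply/fintype.subsetP => j; rewrite !inE => /andP[jc jm]; apply/andP; split.
    by apply: contraTneq jm => ->; rewrite -leqNgt.
  by apply: (ms_centers hG) => //; rewrite eq_sym.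
have leaf (k : 'I_K) : (k < m)%N -> exists j : 'I_K, e k j && (m <= j)%N.
  move=> km; apply/existsP; apply: contraLR (degC _ km).
  rewrite negb_exists => /forallP noleaf; rewrite -ltnNge.
  apply: (@leq_ltn_trans #|C :\ k|%SET).
    apply: subset_leq_card; apply/fintype.subsetP => j; rewrite !inE => ekj.
    have := noleaf j; rewrite ekj /= -ltnNge => ->; rewrite andbT.
    by apply: contraTneq ekj => ->; rewrite (ms_irr hG).
  by rewrite -[ltnRHS]card_centers -/C (cardsD1 k C) inE km.
pose f (k : 'I_K) := odflt k [pick j : 'I_K | e k j && (m <= j)%N].
have fP (k : 'I_K) : (k < m)%N -> e k (f k) && (m <= f k)%N.
  rewrite /f => /leaf[j hj]; case: pickP => [//|/(_ j)]; by rewrite hj.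
have finj : {in C &, injective f}.
  move=> k k'; rewrite !inE => /fP/andP[ek mk] /fP/andP[ek' mk'] ff.
  have [c' _ ec'] := ms_peripheral hG mk.
  move: ek ek'; rewrite -ff !(ms_sym hG _ (f k)) !ec'.
  by move=> /eqP -> /eqP ->.
rewrite -[leqLHS]card_centers -/C -(card_in_imset finj).
have -> : (K - m)%N = #|~: C|%SET.
  by rewrite cardsCs finset.setCK card_ord -[X in (_ - X)%N]card_centers.
apply: subset_leq_card; apply/fintype.subsetP => j /imsetP[k]; rewrite !inE => km ->.
by have /andP[_] := fP k km; rewrite leqNgt.
Qed.

Lemma sum_explore_coef (alpha : R) :
  (forall k : 'I_K, (k < m)%N -> explore_coef m e p k = alpha) ->
  \sum_(k < K) (1 + explore_coef m e p k) = K%:R - m%:R + m%:R * (1 + alpha).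
Proof.
move=> ha; rewrite big_split/= sumr_const card_ord (bigID (fun k : 'I_K => (k < m)%N))/=.
rewrite [X in _ + (_ + X)]big1 ?addr0; last first.
  by move=> k /negPf km; rewrite /explore_coef km.
rewrite (big_ord_narrow (ms_center_le hG))/=.
rewrite (eq_bigr (fun=> alpha)); last by move=> k _; rewrite ha/=.
by rewrite sumr_const card_ord -[alpha *+ m]mulr_natl; ring.
Qed.

End Graph.

Section LeadingConstant.
Context (R : realType) (K m : nat) (e : rel 'I_K) (p alpha : R).
Hypotheses (hG : symmetric_multi_star m e) (p01 : 0 <= p <= 1)
  (halpha : forall k : 'I_K, (k < m)%N -> explore_coef m e p k = alpha).

Let m1 : 1 <= m%:R :> R. Proof. by rewrite ler1n (ms_center_gt0 hG). Qed.

Lemma alpha_ge0 : 0 <= alpha.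
Proof.
have mK := leq_trans (ms_center_gt0 hG) (ms_center_le hG).
by rewrite -(halpha (k := Ordinal mK)) ?(ms_center_gt0 hG)//; exact: explore_coef_ge0.
Qed.

Lemma alpha_le1 : alpha <= 1.
Proof.
have mK := leq_trans (ms_center_gt0 hG) (ms_center_le hG).
by rewrite -(halpha (k := Ordinal mK)) ?(ms_center_gt0 hG)//; exact: explore_coef_le1.
Qed.

Let p0 : 0 <= p. Proof. by have /andP[] := p01. Qed.
Let p1 : p <= 1. Proof. by have /andP[] := p01. Qed.
Let a0 := alpha_ge0.
Let a1 := alpha_le1.

Lemma c1_complete : K = m -> c1 K m alpha p = m%:R * (1 + alpha) / (1 + p * (m%:R - 1)).
Proof.
by move=> ->; rewrite /c1 subrr add0r mul0r mulr0 subr0 max_l// mulr1.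
Qed.

Let den_gt0 : 0 < 1 + p * (m%:R - 1).
Proof. by rewrite ltr_wpDr// mulr_ge0// subr_ge0. Qed.

Lemma c1_peripheral : (m < K)%N -> m%:R <= K%:R - m%:R :> R /\ K%:R - m%:R <= c1 K m alpha p.
Proof.
move=> mK; split.
  by rewrite -natrB ?(ms_center_le hG)// ler_nat (peripheral_count hG).
rewrite /c1 lerDl; apply: mulr_ge0; last by rewrite le_max lexx orbT.
by apply: divr_ge0; [rewrite mulr_ge0// addr_ge0|exact: ltW].
Qed.

Lemma c1_ge1 : 1 <= c1 K m alpha p.
Proof.
have := ms_center_le hG; rewrite leq_eqVlt => /orP[/eqP/esym mK|mK].
  rewrite c1_complete// ler_pdivlMr// mul1r.
  have : p * (m%:R - 1) <= 1 * (m%:R - 1) by rewrite ler_wpM2r// subr_ge0.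
  have : 0 <= m%:R * alpha by rewrite mulr_ge0.
  lra.
have [h1 h2] := c1_peripheral mK; exact: le_trans (le_trans m1 h1) h2.
Qed.

Lemma c1_cases : K%:R - m%:R + m%:R * (1 + alpha) <= 3 * c1 K m alpha p \/
  [/\ K = m, 0 < p & (1 + alpha) / p <= 2 * c1 K m alpha p].
Proof.
have := ms_center_le hG; rewrite leq_eqVlt => /orP[/eqP/esym mK|mK]; last first.
  left; have [h1 h2] := c1_peripheral mK.
  have : m%:R * alpha <= m%:R * 1 by rewrite ler_wpM2l.
  lra.
have m0 : 0 <= m%:R * (1 + alpha) by rewrite mulr_ge0// addr_ge0.
have [pm|pm] := leP (p * (m%:R - 1)) 2.
  left; rewrite c1_complete// mK subrr add0r mulrA ler_pdivlMr//.
  by rewrite mulrC ler_wpM2r//; lra.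
right; have pp : 0 < p.
  by rewrite lt_neqAle p0 andbT; apply: contraTneq pm => <-; rewrite mul0r -leNgt.
split=> //; rewrite c1_complete// mulrA ler_pdivrMr// mulrAC ler_pdivlMr//.
have -> : 2 * (m%:R * (1 + alpha)) * p = (1 + alpha) * (2 * m%:R * p) by ring.
by rewrite ler_wpM2l ?addr_ge0//; lra.
Qed.

End LeadingConstant.

(* The last summand bounds the number of pulls when log T <= 400 K. *)
Definition regret_const (R : realType) (K : nat) (p xi : R) : R :=
  3 * K%:R + K%:R / (1 - link_decay K p) + K%:R ^+ 2 * (1 + (xi - 1)^-1) +
  K%:R * expR (400 * K%:R).

Section ArmPulls.
Context (R : realType) (K m N T : nat) (e : rel 'I_K) (p xi alpha : R)
  (nu : 'I_N -> probability (measurableTypeR R) R) (sigma : 'I_N -> R)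
  (d : measure_display) (Omega : measurableType d) (P : probability Omega R)
  (X : nat -> 'I_K -> 'I_N -> {RV P >-> R})
  (I : nat -> 'I_K -> 'I_K -> Omega -> bool)
  (phi : nat -> 'I_K -> Omega -> 'I_N) (mu : 'I_N -> R) (istar i : 'I_N).
Hypotheses (run : bandit_run m T e p xi nu sigma X I phi)
  (hG : symmetric_multi_star m e) (p01 : 0 <= p <= 1) (xi1 : 1 < xi)
  (halpha : forall k : 'I_K, (k < m)%N -> explore_coef m e p k = alpha)
  (sigma_gt0 : forall i, 0 < sigma i)
  (sg : forall i, sub_gaussian (nu i) (mu i) (sigma i))
  (Delta_gt0 : 0 < mu istar - mu i) (T0 : (0 < T)%N).

Let Delta := mu istar - mu i.
Let scale : R := sigma i ^+ 2 / Delta ^+ 2 * ((xi + 1) * ln T%:R).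
Let K0 : (0 < K)%N.
Proof. exact: leq_trans (ms_center_gt0 hG) (ms_center_le hG). Qed.

Let scale_ge0 : 0 <= scale.
Proof.
rewrite mulr_ge0 ?divr_ge0 ?sqr_ge0// mulr_ge0 ?ln_nat_ge0//.
by rewrite addr_ge0// ltW// (lt_trans ltr01).
Qed.

Let sample k := sample_bound m T e p xi sigma mu istar i k.

Let sampleE k : sample k = 200 / 81 * (1 + explore_coef m e p k) * scale.
Proof. by rewrite /sample /sample_bound /index_coef /scale -/Delta; field; rewrite gt_eqF. Qed.

Let sample_ge0 k : 0 <= sample k.
Proof.
by rewrite sampleE mulr_ge0// mulr_ge0// addr_ge0// explore_coef_ge0.
Qed.

Let rare k t w := rarely_sampled m T e p xi sigma I phi mu istar i k t w.

Lemma rare_bound : exists2 G : Omega -> R, measurable_fun setT G &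
  (forall w, \sum_(k < K) \sum_(0 <= t < T) (rare k t w)%:R <= G w) /\
  ('E_P[G] <= (200 / 27 * c1 K m alpha p * scale + (2 * K%:R +
     K%:R / (1 - link_decay K p)))%:E)%E.
Proof.
have dec1 : 0 <= K%:R / (1 - link_decay K p).
  rewrite divr_ge0// subr_ge0 expR_le1 oppr_le0 divr_ge0// mulr_ge0//.
    by have /andP[] := p01.
  by rewrite invr_ge0 mulr_ge0.
have [c3|[Km p0 c2]] := c1_cases hG p01 halpha.
  exists (cst (\sum_(k < K) (sample k + 1))); first exact: measurable_cst.
  split=> [w|]; first by apply: ler_sum => k _; exact: (sum_rarely_sampled run).
  rewrite expectation_cst lee_fin big_split/= sumr_const card_ord.
  under eq_bigr do rewrite sampleE.
  rewrite -mulr_suml -mulr_sumr (sum_explore_coef hG halpha).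
  have := ler_wpM2r scale_ge0 c3.
  have : 0 <= K%:R :> R by []. 
  lra.
have complete := complete_of_no_peripheral hG Km.
have p01' : 0 < p <= 1 by rewrite p0; have /andP[] := p01.
have lt_m (k : 'I_K) : (k < m)%N by rewrite -[ltnRHS]Km.
pose l := 200 / 81 * (1 + alpha) * scale.
have sl k : sample k = l by rewrite sampleE halpha.
have l0 : 0 <= l by rewrite -(sl (Ordinal K0)).
pose q := 3 / 4 * p.
have q0 : 0 < q by rewrite mulr_gt0// divr_gt0.
pose V k w := \sum_(0 <= t < T) link_potential p I phi i k t w *
  (chosen (choosers phi t.+1 i w))%:R.
have mVt k t : (t < T)%N -> measurable_fun setT (fun w =>
    link_potential p I phi i k t w * (chosen (choosers phi t.+1 i w))%:R).
  move=> tT; apply: measurable_funM; last exact: (measurable_chosen run).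
  by apply: (past_measurable_fun run tT); exact: past_link_potential.
have Vt0 k t w : 0 <= link_potential p I phi i k t w *
    (chosen (choosers phi t.+1 i w))%:R by rewrite mulr_ge0// expR_ge0.
have mV k : measurable_fun setT (V k) by apply: measurable_sum_nat => t; exact: mVt.
have V0 k w : 0 <= V k w by apply: sumr_ge0 => t _; exact: Vt0.
have lq0 : 0 <= l / q + K%:R by rewrite addr_ge0// divr_ge0// ltW.
exists (fun w => l / q + K%:R + \sum_(k < K) V k w).
  by apply: measurable_funD => //; exact: measurable_sum.
split=> [w|].
  apply: le_trans (lerD (sum_total_count T phi i w (divr_ge0 l0 (ltW q0))) (lexx _)).
  rewrite exchange_big/= /V [X in _ <= _ + X]exchange_big/= -big_split/=.
  apply: ler_sum => t _.
  rewrite natr_sum mulr_suml -big_split/=; apply: ler_sum => k _.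
  rewrite /rare /rarely_sampled -/(sample k) sl.
  case ch: (choosers _ _ _ _ _) => /=; last by rewrite mul0r add0r.
  have -> : chosen (choosers phi t.+1 i w) by apply/existsP; exists k.
  rewrite mul1r mulr1.
  have [_|lt_tot] := leP (total_count phi i t w)%:R (l / q).
    by apply: ler_wpDr; [exact: expR_ge0|rewrite lern1 leq_b1].
  have [obs_le|_] := leP _ l; last by rewrite add0r expR_ge0.
  rewrite add0r -[leLHS]expR0 ler_expR; apply: mulr_ge0.
    by apply: ltW; exact: link_rate_gt0.
  rewrite subr_ge0.
  apply: le_trans obs_le _; rewrite -/q mulrC -ler_pdivrMr//; exact: ltW.
rewrite ge0_expectationD//; last 2 first.
- exact: measurable_sum.
- by move=> w; exact: sumr_ge0.
rewrite expectation_cst ge0_expectation_sum//.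
have dec : 0 < 1 - link_decay K p by rewrite subr_gt0 link_decay_lt1.
have EV k : ('E_P[V k] <= ((1 - link_decay K p)^-1)%:E)%E.
  rewrite /V ge0_expectation_sum_nat//; last by move=> t; exact: mVt.
  rewrite -[leRHS]mule1 lee_pdivlMl//.
  exact: (link_potential_sum run).
apply: (@le_trans _ _ ((l / q + K%:R)%:E + \sum_(k < K) ((1 - link_decay K p)^-1)%:E)%E).
  by apply: leeD => //; apply: lee_sum.
rewrite sumEFin sumr_const card_ord -[_^-1 *+ K]mulr_natl -EFinD lee_fin.
have -> : l / q = 800 / 243 * ((1 + alpha) / p * scale).
  by rewrite /l /q; field; rewrite gt_eqF.
have := ler_wpM2r scale_ge0 c2; have : 0 <= K%:R :> R by [].
have : 0 <= c1 K m alpha p * scale.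
  by rewrite mulr_ge0// (le_trans ler01 (c1_ge1 hG p01 halpha)).
lra.
Qed.

Lemma arm_pulls :
  (\sum_(k < K) 'E_P[fun w => (own_count phi i k T w)%:R] <=
   (8 * c1 K m alpha p * scale + regret_const K p xi)%:E)%E.
Proof.
have c11 := c1_ge1 hG p01 halpha.
have xi0 : 0 <= (xi - 1)^-1 by rewrite invr_ge0 subr_ge0 ltW.
have dec1 : 0 <= K%:R / (1 - link_decay K p).
  rewrite divr_ge0// subr_ge0 expR_le1 oppr_le0 divr_ge0// mulr_ge0//.
    by have /andP[] := p01.
  by rewrite invr_ge0 mulr_ge0.
have xi2 : 0 <= K%:R ^+ 2 * (1 + (xi - 1)^-1) by rewrite mulr_ge0 ?sqr_ge0// addr_ge0.
have KR : 0 <= K%:R :> R by [].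
have eK : 0 <= K%:R * expR (400 * K%:R) :> R by rewrite mulr_ge0 ?expR_ge0.
have cs : 0 <= c1 K m alpha p * scale by rewrite mulr_ge0// (le_trans ler01).
have [Tsmall|Tbig] := leP (ln T%:R) (400 * K%:R : R).
  apply: (@le_trans _ _ (\sum_(k < K) T%:R%:E)%E).
    apply: lee_sum => k _; rewrite -(expectation_cst P).
    apply: ge0_le_expectation => //; first exact: (measurable_own_count run).
    by move=> w; rewrite ler_nat own_count_le.
  rewrite sumEFin sumr_const card_ord -[T%:R *+ K]mulr_natl lee_fin.
  have : K%:R * T%:R <= K%:R * expR (400 * K%:R) :> R.
    by rewrite ler_wpM2l// -[leLHS]lnK ?posrE ?ltr0n// ler_expR.
  by rewrite /regret_const; lra.
have [G mG [hG1 hG2]] := rare_bound.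
apply: le_trans (arm_expectation run sg sigma_gt0 xi1 _ Delta_gt0 mG hG1 hG2) _.
  by move=> k; exact: explore_coef_ge0.
rewrite lee_fin -/Delta /regret_const.
set u := sigma i ^+ 2 / Delta ^+ 2.
have u0 : 0 <= u by rewrite divr_ge0 ?sqr_ge0.
have x0 : 800 * K%:R <= (xi + 1) * ln T%:R.
  apply: (@le_trans _ _ (2 * ln T%:R)).
    have -> : 800 * K%:R = 2 * (400 * K%:R) :> R by ring.
    by rewrite ler_wpM2l// ltW.
  by rewrite ler_wpM2r ?ln_nat_ge0// lerD2r ltW.
have : K%:R * (400 * u) <= 1 / 2 * (c1 K m alpha p * scale).
  have : u * (800 * K%:R) <= scale by rewrite ler_wpM2l.
  have : 1 * scale <= c1 K m alpha p * scale by rewrite ler_wpM2r.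
  lra.
lra.
Qed.

End ArmPulls.

Theorem theorem1 (R : realType) (K m : nat) (e : rel 'I_K) (p xi alpha : R)
    (hG : symmetric_multi_star m e)
    (hp : 0 <= p <= 1)
    (hxi : 1 < xi)
    (halpha : forall k : 'I_K, (k < m)%N -> explore_coef m e p k = alpha) :
  exists2 zeta : R, 1 < zeta &
    forall (N T : nat)
      (nu : 'I_N -> probability (measurableTypeR R) R) (mu sigma : 'I_N -> R)
      (istar : 'I_N)
      (d : measure_display) (Omega : measurableType d) (P : probability Omega R)
      (X : nat -> 'I_K -> 'I_N -> {RV P >-> R})
      (I : nat -> 'I_K -> 'I_K -> Omega -> bool)
      (phi : nat -> 'I_K -> Omega -> 'I_N),
    (0 < T)%N ->
    (forall i, 0 < sigma i) ->
    (forall i, sub_gaussian (nu i) (mu i) (sigma i)) ->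
    (forall i, mu i <= mu istar) ->
    bandit_run m T e p xi nu sigma X I phi ->
    let Delta i := mu istar - mu i in
    let b := xi * alpha + xi + alpha in
    let dcen := center_degree R K m in
    (group_regret P phi Delta T <=
      (c1 K m alpha p *
         \sum_(i < N | 0 < Delta i)
            8 * sigma i ^+ 2 * (xi + 1) * ln T%:R / Delta i
       + 2 / ln zeta *
         \sum_(i < N) Delta i *
           (K%:R * ln (1 + avg_degree R e)
            + (K%:R - m%:R) * ((xi * ln 2 + 1) / xi ^+ 2)
            + m%:R * ((ln (1 + dcen) * b + 1) / b ^+ 2)))%:E)%E.

Proof.
have K0 : (0 < K)%N := leq_trans (ms_center_gt0 hG) (ms_center_le hG).
have a0 := alpha_ge0 hG halpha.
have m1 : 1 <= m%:R :> R by rewrite ler1n (ms_center_gt0 hG).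
have mK : m%:R <= K%:R :> R by rewrite ler_nat (ms_center_le hG).
have K0' : 0 < K%:R :> R by rewrite ltr0n.
pose C := regret_const K p xi.
have C0 : 0 < C.
  rewrite /C /regret_const -!addrA ltr_pwDl ?mulr_gt0//.
  rewrite addr_ge0//; last rewrite addr_ge0// ?mulr_ge0 ?expR_ge0 ?sqr_ge0//.
    rewrite divr_ge0// subr_ge0 expR_le1 oppr_le0 divr_ge0// mulr_ge0//.
      by have /andP[] := hp.
    by rewrite invr_ge0 mulr_ge0.
  by rewrite addr_ge0// invr_ge0 subr_ge0 ltW.
pose b := xi * alpha + xi + alpha; pose dcen := center_degree R K m.
pose B := K%:R * ln (1 + avg_degree R e)
  + (K%:R - m%:R) * ((xi * ln 2 + 1) / xi ^+ 2)
  + m%:R * ((ln (1 + dcen) * b + 1) / b ^+ 2).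
have xi0 : 0 < xi := lt_trans ltr01 hxi.
have b0 : 0 < b by rewrite ltr_wpDr// ltr_wpDl// mulr_ge0// ltW.
have dcen0 : 0 <= dcen.
  by rewrite /dcen /center_degree -addrA addr_ge0 ?divr_ge0 ?subr_ge0.
have avg0 : 0 <= avg_degree R e by rewrite divr_ge0// sumr_ge0.
have B0 : 0 < B.
  rewrite /B ltr_wpDl//; last first.
    rewrite mulr_gt0 ?divr_gt0 ?exprn_gt0// ?(lt_le_trans ltr01 m1)//.
    by rewrite ltr_wpDl// mulr_ge0 ?ln_ge0 ?lerDl// ltW.
  have ln1 : 0 <= K%:R * ln (1 + avg_degree R e) by rewrite mulr_ge0// ln_ge0// lerDl.
  rewrite addr_ge0// mulr_ge0 ?subr_ge0// divr_ge0 ?sqr_ge0// addr_ge0//.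
  by rewrite mulr_ge0 ?ln_ge0 ?ler1n// ltW.
exists (expR (2 * B / C)); first by rewrite expR_gt1 divr_gt0// mulr_gt0.
move=> N T nu mu sigma istar d Omega P X I phi T0 sigma0 sg opt run.
rewrite /= -/b -/dcen -/B expRK; pose Delta i := mu istar - mu i.
have BC x : 2 / (2 * B / C) * (x * B) = x * C by field; rewrite !gt_eqF.
have -> : 2 / (2 * B / C) * (\sum_(i < N) (mu istar - mu i) * B) =
    \sum_(i < N) Delta i * C.
  by rewrite mulr_sumr; apply: eq_bigr => i _; exact: BC.
rewrite mulr_sumr [X in X + _]big_mkcond/= -big_split/= -sumEFin.
apply: lee_sum => i _.
rewrite -/(Delta i) -ge0_sume_distrr; last by move=> k _; exact: expectation_ge0.
have D0 : 0 <= Delta i by rewrite subr_ge0.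
have [Dgt|Dle] := ltP 0 (Delta i); last first.
  have -> : Delta i = 0 by apply/eqP; rewrite eq_le Dle D0.
  by rewrite mul0e mul0r addr0.
have := arm_pulls run hG hp hxi halpha sigma0 sg Dgt T0.
move=> /(lee_wpmul2l (_ : 0 <= (Delta i)%:E)%E) h.
apply: le_trans (h _) _; first by rewrite lee_fin.
rewrite -EFinM lee_fin mulrDr lerD2r le_eqVlt; apply/orP; left; apply/eqP.
by rewrite -/(Delta i); field; rewrite gt_eqF.
Qed.
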